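(* Let $A$ be a finite dimensional algebra over a field and $U=\bigoplus_{i=1}^mU_i\in2\text{-}\mathsf{psilt}\,A$ with each $U_i$ indecomposable. Then $$D(U)=\{\theta\in K_0(\mathsf{proj}\,A)_{\mathbb R}\mid Y^+\in\overline{\mathcal T}_\theta,\ X^-\in\overline{\mathcal F}_\theta\}=\bigcap_{i=1}^m\{\theta\in K_0(\mathsf{proj}\,A)_{\mathbb R}\mid Y_i^+\in\overline{\mathcal T}_\theta,\ X_i^-\in\overline{\mathcal F}_\theta\},$$ $$D^\circ(U)=\{\theta\in K_0(\mathsf{proj}\,A)_{\mathbb R}\mid Y^+\in\mathcal T_\theta,\ X^-\in\mathcal F_\theta\}=\bigcap_{i=1}^m\{\theta\in K_0(\mathsf{proj}\,A)_{\mathbb R}\mid Y_i^+\in\mathcal T_\theta,\ X_i^-\in\mathcal F_\theta\}.$$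
   Context: Let $K$ be a field and $A$ a finite dimensional $K$-algebra. $\mathsf{mod}\,A$, $\mathsf{proj}\,A$, $\mathsf{inj}\,A$ are the categories of finitely generated (f.g.), f.g. projective, f.g. injective right $A$-modules; $\mathsf K^{\mathrm b}(\mathsf{proj}\,A)$ is the homotopy category of bounded complexes; $\nu\colon\mathsf K^{\mathrm b}(\mathsf{proj}\,A)\to\mathsf K^{\mathrm b}(\mathsf{inj}\,A)$ is the Nakayama functor. $n:=|A|$ is the number of isoclasses of indecomposable projective $A$-modules. $U\in\mathsf K^{\mathrm b}(\mathsf{proj}\,A)$ is presilting if $\mathrm{Hom}(U,U[\ell])=0$ for all $\ell\ge1$, and 2-term if it is isomorphic to a complex concentrated in degrees $-1,0$. $2\text{-}\mathsf{psilt}\,A$ is the set of isoclasses of basic 2-term presilting complexes. $K_0(\mathsf{proj}\,A)_{\mathbb R}:=K_0(\mathsf{proj}\,A)\otimes_{\mathbb Z}\mathbb R\cong\mathbb R^n$. Each $\theta\in K_0(\mathsf{proj}\,A)_{\mathbb R}$ is a linear form on $K_0(\mathsf{mod}\,A)_{\mathbb R}$ via the Euler bilinear form, determined by $\langle[P],[M]\rangle=\dim_K\mathrm{Hom}_A(P,M)$ for $P\in\mathsf{proj}\,A$, $M\in\mathsf{mod}\,A$; write $\theta(M):=\langle\theta,[M]\rangle$. Define subcategories of $\mathsf{mod}\,A$: $M\in\overline{\mathcal T}_\theta$ (resp. $\mathcal T_\theta$) iff $\theta(X)\ge0$ (resp. $>0$) for all nonzero factor modules $X$ of $M$; $M\in\overline{\mathcal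 F}_\theta$ (resp. $\mathcal F_\theta$) iff $\theta(Y)\le0$ (resp. $<0$) for all nonzero submodules $Y$ of $M$. $D(U):=\{\theta\mid H^0(U)\in\overline{\mathcal T}_\theta,\ H^{-1}(\nu U)\in\overline{\mathcal F}_\theta\}$, $D^\circ(U):=\{\theta\mid H^0(U)\in\mathcal T_\theta,\ H^{-1}(\nu U)\in\mathcal F_\theta\}$. For $i\in\{1,\ldots,m\}$, with $\mathrm{rad}_A(-,-)$ the radical of the category $\mathsf{mod}\,A$, $$Y_i^+:=H^0(U_i)\Big/\sum_{f\in\mathrm{rad}_A(H^0(U),H^0(U_i))}\mathrm{Im}\,f,\qquad X_i^-:=\bigcap_{f\in\mathrm{rad}_A(H^{-1}(\nu U_i),H^{-1}(\nu U))}\mathrm{Ker}\,f,$$ each of which is a brick or zero, and $Y^+:=\bigoplus_{i=1}^mY_i^+$, $X^-:=\bigoplus_{i=1}^mX_i^-$. *)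

(* Defs.v *)
From HB Require Import structures.
From mathcomp Require Import all_boot all_order all_algebra all_field.
From mathcomp Require Import boolp classical_sets reals.
From mathcomp Require Import generic_quotient ring_quotient.
From mathcomp Require freeg.
Import -(notations) freeg.

Set Implicit Arguments.
Unset Strict Implicit.
Unset Printing Implicit Defensive.

Import GRing.Theory.
Local Open Scope classical_set_scope.
Local Open Scope ring_scope.

Section LinearAlgebra.
Variable K : fieldType.

Lemma linfunE (V W : vectType K) (f : V -> W) (fL : linear f) :
  linfun f =1 f.
Proof.
pose F : {linear V -> W} :=
  HB.pack f (GRing.isSemilinear.Build K V W _ f (GRing.semilinear_linear fL)).
exact: (lfunE F).
Qed.

Definition is_vspan (V : vectType K) (S : set V) (W : {vspace V}) :=
  (forall v, S v -> v \in W) /\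
  (forall W' : {vspace V}, (forall v, S v -> v \in W') -> (W <= W')%VS).

(* The smallest subspace containing an arbitrary (possibly infinite) set. *)
Definition vspan (V : vectType K) (S : set V) : {vspace V} :=
  xget 0%VS [set W | is_vspan S W].

Lemma finite_vspan (V : vectType K) (S : set V) :
  exists2 X : seq V, (forall v, v \in X -> S v) &
    (forall v, S v -> v \in <<X>>%VS).
Proof.
apply: contrapT => noX.
have grow n : exists2 X : seq V, (forall v, v \in X -> S v) &
    (n <= \dim <<X>>%VS)%N.
  elim: n => [|n [X XS nX]]; first by exists [::].
  have [XT|XT] := pselect (forall v, S v -> v \in <<X>>%VS).
    by case: noX; exists X.
  have /existsNP[w /not_implyP[Sw /negP wX]] := XT.
  exists (w :: X) => [w'|]; first by rewrite inE => /orP[/eqP->|/XS].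
  apply: leq_ltn_trans nX _.
  rewrite ltnNge; apply/negP => le; move/negP: wX; apply.
  have sub : (<<X>> <= <<w :: X>>)%VS by rewrite span_cons addvSr.
  have /eqP-> : (<<X>> == <<w :: X>>)%VS by rewrite eqEdim sub.
  by rewrite memv_span ?mem_head.
have [X _] := grow (\dim {:V}).+1.
by apply/negP; rewrite -leqNgt dimvS // subvf.
Qed.

Lemma vspanP (V : vectType K) (S : set V) : is_vspan S (vspan S).
Proof.
rewrite /vspan; case: xgetP => [W _ //|noW]; exfalso.
have [X XS SX] := finite_vspan S; apply: (noW <<X>>%VS); split=> // W' SW'.
by apply/span_subvP => v /XS /SW'.
Qed.

Lemma mem_vspan (V : vectType K) (S : set V) v : S v -> v \in vspan S.
Proof. by case: (vspanP S) => + _; apply. Qed.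

Lemma vspan_subv (V : vectType K) (S : set V) (W : {vspace V}) :
  (forall v, S v -> v \in W) -> (vspan S <= W)%VS.
Proof. by case: (vspanP S) => _; apply. Qed.

Lemma vspanE (V : vectType K) (S : set V) :
  S 0 -> (forall k u v, S u -> S v -> S (k *: u + v)) ->
  forall v, (v \in vspan S) <-> S v.
Proof.
move=> S0 SL v; split; last exact: mem_vspan.
have [X XS SX] := finite_vspan S.
move=> /(subvP (vspan_subv SX)); rewrite -[X]/(tval (in_tuple X)).
move=> /coord_span ->.
elim/big_rec: _ => [//|i w _ Sw]; apply: SL => //.
by apply: XS; rewrite mem_nth.
Qed.

End LinearAlgebra.

Section Modules.
Variables (K : fieldType) (A : falgType K).

Definition is_action (V : vectType K) (act : V -> A -> V) :=
  [/\ forall a, linear (act^~ a),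
      forall v, linear (act v),
      forall v, act v 1 = v &
      forall v a b, act v (a * b) = act (act v a) b].

(* Finitely generated right modules: since A is finite dimensional over K,
   these are the right modules that are finite dimensional over K. *)
Record rmodule := RModule {
  rcar :> vectType K;
  ract : rcar -> A -> rcar;
  ractP : is_action ract }.

Definition is_zero (M : rmodule) := (fullv : {vspace M}) = 0%VS.

Definition is_mhom (M N : rmodule) (f : 'Hom(M, N)) :=
  forall m a, f (ract m a) = ract (f m) a.

Definition homA (M N : rmodule) : {vspace 'Hom(M, N)} :=
  vspan [set f : 'Hom(M, N) | is_mhom f].

Definition is_auto (M : rmodule) (f : 'End(M)) :=
  exists g : 'End(M),
    [/\ is_mhom f, is_mhom g, (g \o f)%VF = \1%VF & (f \o g)%VF = \1%VF].

Definition iso_mod (M N : rmodule) :=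
  exists (f : 'Hom(M, N)) (g : 'Hom(N, M)),
    [/\ is_mhom f, is_mhom g, (g \o f)%VF = \1%VF & (f \o g)%VF = \1%VF].

Section ActionTheory.
Variable M : rmodule.
Implicit Types (m n : M) (a b : A) (k : K).

Lemma ract_linearl a : linear (fun m => ract m a).
Proof. by case: (ractP M). Qed.
Lemma ract_linearr m : linear (ract m).
Proof. by case: (ractP M). Qed.
Lemma ract1 m : ract m 1 = m.
Proof. by case: (ractP M). Qed.
Lemma ractM m a b : ract m (a * b) = ract (ract m a) b.
Proof. by case: (ractP M). Qed.
Lemma ractD m n a : ract (m + n) a = ract m a + ract n a.
Proof. by have := ract_linearl a 1 m n; rewrite !scale1r. Qed.
Lemma ract0 a : ract (0 : M) a = 0.
Proof. by have := ract_linearl a (-1) 0 0; rewrite !scaleN1r !addNr. Qed.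
Lemma ractZ k m a : ract (k *: m) a = k *: ract m a.
Proof. by have := ract_linearl a k m 0; rewrite !addr0 ract0 addr0. Qed.
Lemma ractB m n a : ract (m - n) a = ract m a - ract n a.
Proof. by rewrite ractD -scaleN1r ractZ scaleN1r. Qed.
End ActionTheory.

Lemma mhom0 (M N : rmodule) : is_mhom (0 : 'Hom(M, N)).
Proof. by move=> m a; rewrite !zero_lfunE ract0. Qed.

Lemma mhomL (M N : rmodule) k (f g : 'Hom(M, N)) :
  is_mhom f -> is_mhom g -> is_mhom (k *: f + g).
Proof.
by move=> fA gA m a; rewrite !lfun_simp fA gA ractD ractZ.
Qed.

Lemma mhom_comp (M N P : rmodule) (g : 'Hom(N, P)) (f : 'Hom(M, N)) :
  is_mhom g -> is_mhom f -> is_mhom (g \o f)%VF.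
Proof. by move=> gA fA m a; rewrite !comp_lfunE fA gA. Qed.

Lemma mhom_id (M : rmodule) : is_mhom (\1%VF : 'End(M)).
Proof. by move=> m a; rewrite !id_lfunE. Qed.

Lemma mem_homA (M N : rmodule) (f : 'Hom(M, N)) : f \in homA M N <-> is_mhom f.
Proof. by apply: vspanE; [exact: mhom0|move=> *; exact: mhomL]. Qed.

Lemma homA_mhom (M N : rmodule) (f : subvs_of (homA M N)) : is_mhom (vsval f).
Proof. by apply/mem_homA; exact: subvsP. Qed.

Record submod (M : rmodule) := Submod {
  svs :> {vspace M};
  svsP : forall m a, m \in svs -> ract m a \in svs }.

Definition smod_act (M : rmodule) (N : submod M) (v : subvs_of N) (a : A) :
  subvs_of N := vsproj N (ract (vsval v) a).

Lemma smod_actP (M : rmodule) (N : submod M) : is_action (@smod_act M N).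
Proof.
have actE (v : subvs_of N) a : vsval (smod_act v a) = ract (vsval v) a.
  by rewrite vsprojK // svsP // subvsP.
split=> [a k u v|v k a b|v|v a b]; apply: val_inj;
  rewrite /= ?actE /=.
- exact: ract_linearl.
- exact: ract_linearr.
- exact: ract1.
- exact: ractM.
Qed.

Definition smod (M : rmodule) (N : submod M) : rmodule :=
  RModule (smod_actP N).

(* M / N is realized on a complement of N; qproj N is the canonical
   projection, see qproj_mhom, qproj_surj and lker_qproj. *)
Definition qproj_fun (M : rmodule) (N : submod M) (m : M) :
  subvs_of (svs N)^C%VS := vsproj _ (daddv_pi (svs N)^C%VS N m).

Definition qmod_act (M : rmodule) (N : submod M)
  (v : subvs_of (svs N)^C%VS) (a : A) : subvs_of (svs N)^C%VS :=
  qproj_fun N (ract (vsval v) a).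

Lemma qproj_fun_linear (M : rmodule) (N : submod M) : linear (qproj_fun N).
Proof. by move=> k u v; rewrite /qproj_fun !linearP. Qed.

Lemma qproj_val (M : rmodule) (N : submod M) (m : M) :
  vsval (qproj_fun N m) = daddv_pi (svs N)^C%VS N m.
Proof. by rewrite vsprojK // memv_pi. Qed.

Lemma qproj_valK (M : rmodule) (N : submod M) (m : M) :
  m - vsval (qproj_fun N m) \in svs N.
Proof.
rewrite qproj_val -{1}(daddv_pi_add (U := (svs N)^C%VS) (V := N) (w := m)).
- by rewrite addrC addKr memv_pi.
- by rewrite capvC capv_compl.
- by rewrite addvC addv_complf memvf.
Qed.

Lemma qproj_fun_eq0 (M : rmodule) (N : submod M) (m : M) :
  (qproj_fun N m == 0) = (m \in svs N).
Proof.
apply/eqP/idP => [m0|mN]; first by have := qproj_valK N m; rewrite m0 subr0.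
apply: val_inj; apply/eqP; rewrite /= -memv0.
rewrite -(capv_compl N) memv_cap subvsP andbT.
by rewrite -[vsval _](subKr m) memvB ?qproj_valK.
Qed.

Lemma qproj_funB (M : rmodule) (N : submod M) (m n : M) :
  qproj_fun N (m - n) = qproj_fun N m - qproj_fun N n.
Proof.
by rewrite addrC -scaleN1r qproj_fun_linear scaleN1r addrC.
Qed.

Lemma qmod_qproj (M : rmodule) (N : submod M) (m : M) a :
  qmod_act (qproj_fun N m) a = qproj_fun N (ract m a).
Proof.
apply/esym/eqP; rewrite -subr_eq0 -qproj_funB qproj_fun_eq0 -ractB.
exact/svsP/qproj_valK.
Qed.

Lemma qproj_funK (M : rmodule) (N : submod M) (v : subvs_of (svs N)^C%VS) :
  qproj_fun N (vsval v) = v.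
Proof.
apply: val_inj; rewrite /= qproj_val daddv_pi_id ?subvsP //.
by rewrite capvC capv_compl.
Qed.

Lemma qmod_actP (M : rmodule) (N : submod M) : is_action (@qmod_act M N).
Proof.
split=> [a k u v|v k a b|v|v a b].
- by rewrite /qmod_act linearP ract_linearl qproj_fun_linear.
- by rewrite /qmod_act ract_linearr qproj_fun_linear.
- by rewrite /qmod_act ract1 qproj_funK.
- by rewrite -[v]qproj_funK !qmod_qproj ractM.
Qed.

Definition qmod (M : rmodule) (N : submod M) : rmodule :=
  RModule (qmod_actP N).

Definition qproj (M : rmodule) (N : submod M) : 'Hom(M, qmod N) :=
  linfun (qproj_fun N).

Lemma qprojE (M : rmodule) (N : submod M) m : qproj N m = qproj_fun N m.
Proof. exact/linfunE/qproj_fun_linear. Qed.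

Lemma qproj_mhom (M : rmodule) (N : submod M) : is_mhom (qproj N).
Proof. by move=> m a; rewrite !qprojE /= qmod_qproj. Qed.

Lemma qproj_surj (M : rmodule) (N : submod M) : limg (qproj N) = fullv.
Proof.
apply/vspaceP => v; rewrite memvf; apply/memv_imgP.
by exists (vsval v); rewrite ?memvf // qprojE qproj_funK.
Qed.

Lemma lker_qproj (M : rmodule) (N : submod M) : lker (qproj N) = N.
Proof. by apply/vspaceP => m; rewrite memv_ker qprojE qproj_fun_eq0. Qed.

Definition zmod_act (v : 'rV[K]_0) (a : A) : 'rV[K]_0 := 0.

Lemma zmod_actP : is_action zmod_act.
Proof.
have eq0 (u v : 'rV[K]_0) : u = v by apply/rowP; case.
by split=> [a k u v|v k a b|v|v a b]; exact: eq0.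
Qed.

Definition mzero : rmodule := RModule zmod_actP.

Definition dsum_act (M N : rmodule) (v : M * N) (a : A) : M * N :=
  (ract v.1 a, ract v.2 a).

Lemma dsum_actP (M N : rmodule) : is_action (@dsum_act M N).
Proof.
split=> [a k [u1 u2] [v1 v2]|[v1 v2] k a b|[v1 v2]|[v1 v2] a b];
  rewrite /dsum_act /=.
- by congr pair; exact: ract_linearl.
- by congr pair; exact: ract_linearr.
- by rewrite !ract1.
- by rewrite !ractM.
Qed.

Definition mdsum (M N : rmodule) : rmodule := RModule (@dsum_actP M N).

Lemma regular_actP : is_action (fun x a : A => x * a).
Proof.
split=> [a k u v|v k a b|v|v a b].
- by rewrite mulrDl scalerAl.
- by rewrite mulrDr scalerAr.
- exact: mulr1.
- exact: mulrA.
Qed.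

Definition regular : rmodule := RModule regular_actP.

Definition is_projective (P : rmodule) :=
  forall (M N : rmodule) (g : 'Hom(M, N)) (f : 'Hom(P, N)),
    is_mhom g -> is_mhom f -> limg g = fullv ->
    exists2 h : 'Hom(P, M), is_mhom h & (g \o h)%VF = f.

(* The Nakayama functor P |-> Hom_K(Hom_A(P, A), K).  The left A-module
   structure of Hom_A(P, A) is (a f)(p) = a * f(p), so the right action on
   its dual is (phi a)(f) = phi (a f). *)
Definition nak_car (P : rmodule) : vectType K :=
  'Hom(subvs_of (homA P regular), K^o).

Definition nak_lmul (P : rmodule) (a : A) (f : subvs_of (homA P regular)) :
  subvs_of (homA P regular) := vsproj _ ((amull a : 'End(regular)) \o vsval f)%VF.

Definition nak_act (P : rmodule) (phi : nak_car P) (a : A) : nak_car P :=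
  linfun (fun f => phi (nak_lmul a f)).

Lemma amull_mhom (a : A) : is_mhom (amull a : 'End(regular)).
Proof. by move=> m b; rewrite !lfunE /= mulrA. Qed.

Lemma nak_lmulE (P : rmodule) a (f : subvs_of (homA P regular)) p :
  vsval (nak_lmul a f) p = a * vsval f p.
Proof.
rewrite vsprojK; first by rewrite comp_lfunE lfunE.
by apply/mem_homA/mhom_comp; [exact: amull_mhom|exact: homA_mhom].
Qed.

Lemma nak_lmul_linear (P : rmodule) a : linear (@nak_lmul P a).
Proof.
move=> k f g; apply/val_inj/lfunP => p.
rewrite /= nak_lmulE /= !(add_lfunE, scale_lfunE) !nak_lmulE.
by rewrite mulrDr scalerAr.
Qed.

Lemma nak_actE (P : rmodule) (phi : nak_car P) a f :
  nak_act phi a f = phi (nak_lmul a f).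
Proof. by apply: linfunE => k u v; rewrite nak_lmul_linear linearP. Qed.

Lemma nak_actP (P : rmodule) : is_action (@nak_act P).
Proof.
split=> [a k u v|v k a b|v|v a b]; apply/lfunP => f;
  rewrite ?add_lfunE ?scale_lfunE !nak_actE ?add_lfunE ?scale_lfunE //.
- rewrite -linearP; congr (v _); apply/val_inj/lfunP => p.
  by rewrite /= add_lfunE scale_lfunE !nak_lmulE mulrDl scalerAl.
- by congr (v _); apply/val_inj/lfunP => p; rewrite nak_lmulE mul1r.
- by congr (v _); apply/val_inj/lfunP => p; rewrite !nak_lmulE mulrA.
Qed.

Definition nak (P : rmodule) : rmodule := RModule (@nak_actP P).

Definition nak_pre (P Q : rmodule) (f : 'Hom(P, Q))
  (g : subvs_of (homA Q regular)) : subvs_of (homA P regular) :=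
  vsproj _ (vsval g \o f)%VF.

Definition nak_map (P Q : rmodule) (f : 'Hom(P, Q)) : 'Hom(nak P, nak Q) :=
  linfun (fun phi : nak P => linfun (fun g => phi (nak_pre f g)) : nak Q).

Lemma nak_preE (P Q : rmodule) (f : 'Hom(P, Q)) g p :
  is_mhom f -> vsval (nak_pre f g) p = vsval g (f p).
Proof.
move=> fA; rewrite vsprojK ?comp_lfunE //.
by apply/mem_homA/mhom_comp => //; exact: homA_mhom.
Qed.

Lemma nak_pre_linear (P Q : rmodule) (f : 'Hom(P, Q)) : linear (nak_pre f).
Proof. by move=> k u v; rewrite /nak_pre linearP comp_lfunDl -comp_lfunZl linearP. Qed.

Lemma nak_mapE (P Q : rmodule) (f : 'Hom(P, Q)) (phi : nak P) g :
  (nak_map f phi : nak_car Q) g = (phi : nak_car P) (nak_pre f g).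
Proof.
have inner (psi : nak P) h :
    (linfun (fun g => psi (nak_pre f g)) : nak_car Q) h = psi (nak_pre f h).
  by apply: linfunE => k u v; rewrite nak_pre_linear linearP.
rewrite /nak_map linfunE ?inner // => k u v.
by apply/lfunP => h; rewrite !lfun_simp !inner !lfun_simp.
Qed.

Lemma nak_map_mhom (P Q : rmodule) (f : 'Hom(P, Q)) :
  is_mhom f -> is_mhom (nak_map f).
Proof.
move=> fA phi a; apply/lfunP => g; rewrite nak_actE !nak_mapE nak_actE.
by congr (phi _); apply/val_inj/lfunP => p; rewrite !(nak_preE, nak_lmulE).
Qed.

Lemma nak_map0 (P Q : rmodule) : nak_map (0 : 'Hom(P, Q)) = 0.
Proof.
apply/lfunP => phi; apply/lfunP => g; rewrite nak_mapE !zero_lfunE.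
suff -> : nak_pre (0 : 'Hom(P, Q)) g = 0 by rewrite linear0.
apply/val_inj/lfunP => p; rewrite /= nak_preE; last exact: mhom0.
by rewrite !zero_lfunE linear0.
Qed.

Lemma nak_map_comp (P Q S : rmodule) (g : 'Hom(Q, S)) (f : 'Hom(P, Q)) :
  is_mhom f -> is_mhom g -> nak_map (g \o f)%VF = (nak_map g \o nak_map f)%VF.
Proof.
move=> fA gA; apply/lfunP => phi; apply/lfunP => h.
rewrite comp_lfunE !nak_mapE; congr (phi _); apply/val_inj/lfunP => p.
by rewrite !nak_preE ?comp_lfunE //; exact: mhom_comp.
Qed.

Definition rad (M N : rmodule) (f : 'Hom(M, N)) :=
  is_mhom f /\
  forall g : 'Hom(N, M), is_mhom g -> is_auto (\1 - (g \o f))%VF.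

Lemma vspan_stable (M : rmodule) (S : set M) :
  (forall m a, S m -> S (ract m a)) ->
  forall m a, m \in vspan S -> ract m a \in vspan S.
Proof.
move=> SA m a mS; have aE := linfunE (@ract_linearl M a).
suff /subvP/(_ _ mS) :
    (vspan S <= linfun (fun m : M => ract m a) @^-1: vspan S)%VS.
  by rewrite -memv_preim aE.
by apply: vspan_subv => v Sv; rewrite -memv_preim aE mem_vspan //; exact: SA.
Qed.

Definition rad_ims (M N : rmodule) : set N :=
  [set y | exists f : 'Hom(M, N), rad f /\ exists x, y = f x].

Lemma rad_ims_stable (M N : rmodule) (y : N) a :
  rad_ims M y -> rad_ims M (ract y a).
Proof.
by case=> f [fR [x ->]]; exists f; split=> //; exists (ract x a); case: fR => ->.
Qed.

(* The sum of the images of all radical morphisms M -> N. *)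
Definition rad_trace (M N : rmodule) : submod N :=
  Submod (vspan_stable (@rad_ims_stable M N)).

Definition rad_kers (M N : rmodule) : set M :=
  [set x | forall f : 'Hom(M, N), rad f -> f x = 0].

Lemma rad_kers_stable (M N : rmodule) (x : M) a :
  rad_kers N x -> rad_kers N (ract x a).
Proof. by move=> xR f fR; case: (fR) => -> _; rewrite xR ?ract0. Qed.

(* The intersection of the kernels of all radical morphisms M -> N, which is
   already a subspace (mem_rad_reject). *)
Definition rad_reject (M N : rmodule) : submod M :=
  Submod (vspan_stable (@rad_kers_stable M N)).

Lemma mem_rad_reject (M N : rmodule) (x : M) :
  x \in svs (rad_reject M N) <-> rad_kers N x.
Proof.
apply: vspanE => [f _|k u v uR vR f fR]; first by rewrite linear0.
by rewrite linearP /= (uR f fR) (vR f fR) scaler0 addr0.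
Qed.

End Modules.

Section Complexes.
Variables (K : fieldType) (A : falgType K).
Local Notation rmodule := (rmodule A).

(* Cochain complexes.  The differential is a family indexed by all pairs of
   degrees that vanishes unless j = i + 1, to avoid transports. *)
Record cplx := Cplx {
  cob :> int -> rmodule;
  cd : forall i j, 'Hom(cob i, cob j);
  cd_mhom : forall i j, is_mhom (cd i j);
  cd_shape : forall i j, j != i + 1 -> cd i j = 0;
  cd_sq : forall i j k, (cd j k \o cd i j)%VF = 0 }.

Definition in_Kb_proj (C : cplx) :=
  (exists n : nat, forall i : int, (n < `|i|)%N -> is_zero (C i)) /\
  (forall i, is_projective (C i)).

Definition cmap (C D : cplx) := forall i, 'Hom(C i, D i).

Definition is_cmap (C D : cplx) (f : cmap C D) :=
  (forall i, is_mhom (f i)) /\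
  (forall i j, (cd D i j \o f i)%VF = (f j \o cd C i j)%VF).

Definition null_homotopic (C D : cplx) (f : cmap C D) :=
  exists h : forall i j, 'Hom(C i, D j),
    (forall i j, is_mhom (h i j)) /\
    (forall i, f i = (cd D (i - 1) i \o h i (i - 1)%R)%VF
                     + (h (i + 1)%R i \o cd C i (i + 1))%VF).

(* Isomorphism in the homotopy category. *)
Definition iso_K (C D : cplx) :=
  exists (f : cmap C D) (g : cmap D C),
    [/\ is_cmap f, is_cmap g,
        null_homotopic (fun i => (g i \o f i)%VF - \1%VF) &
        null_homotopic (fun i => (f i \o g i)%VF - \1%VF)].

Section Shift.
Variables (l : nat) (C : cplx).

Definition shift_d (i j : int) : 'Hom(C (i + l%:Z), C (j + l%:Z)) :=
  (-1) ^+ l *: cd C (i + l%:Z) (j + l%:Z).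

Lemma shift_mhom i j : is_mhom (shift_d i j).
Proof. by rewrite -[shift_d i j]addr0; apply: mhomL; [exact: cd_mhom|exact: mhom0]. Qed.

Lemma shift_shape i j : j != i + 1 -> shift_d i j = 0.
Proof.
move=> ij; rewrite /shift_d cd_shape ?scaler0 //.
by apply: contraNneq ij => /eqP; rewrite addrAC => /eqP/addIr ->.
Qed.

Lemma shift_sq i j k : (shift_d j k \o shift_d i j)%VF = 0.
Proof. by rewrite /shift_d -comp_lfunZl -comp_lfunZr cd_sq !scaler0. Qed.

Definition shift : cplx := Cplx shift_mhom shift_shape shift_sq.
End Shift.

Lemma czero_mhom (i j : int) : is_mhom (0 : 'Hom(mzero A, mzero A)).
Proof. exact: mhom0. Qed.

Definition czero : cplx :=
  @Cplx (fun=> mzero A) (fun _ _ => 0) czero_mhom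
    (fun _ _ _ => erefl) (fun _ _ _ => comp_lfun0r _ _).

Section DirectSum.
Variables C D : cplx.

Definition cdsum_d (i j : int) :
    'Hom(mdsum (C i) (D i), mdsum (C j) (D j)) :=
  linfun (fun v : (C i * D i)%type => (cd C i j v.1, cd D i j v.2)).

Lemma cdsum_dE i j v : cdsum_d i j v = (cd C i j v.1, cd D i j v.2).
Proof.
rewrite linfunE // => k [u1 u2] [v1 v2] /=.
by rewrite !linearP.
Qed.

Lemma cdsum_mhom i j : is_mhom (cdsum_d i j).
Proof. by move=> [u v] a; rewrite !cdsum_dE /dsum_act /= !cd_mhom. Qed.

Lemma cdsum_shape i j : j != i + 1 -> cdsum_d i j = 0.
Proof.
move=> ij; apply/lfunP => v.
by rewrite cdsum_dE !cd_shape // !zero_lfunE.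
Qed.

Lemma cdsum_sq i j k : (cdsum_d j k \o cdsum_d i j)%VF = 0.
Proof.
by apply/lfunP => v; rewrite comp_lfunE !cdsum_dE /= -!comp_lfunE !cd_sq !zero_lfunE.
Qed.

Definition cdsum : cplx := Cplx cdsum_mhom cdsum_shape cdsum_sq.
End DirectSum.

Section Nakayama.
Variable C : cplx.

Definition cnak_d (i j : int) : 'Hom(nak (C i), nak (C j)) := nak_map (cd C i j).

Lemma cnak_mhom i j : is_mhom (cnak_d i j).
Proof. exact/nak_map_mhom/cd_mhom. Qed.

Lemma cnak_shape i j : j != i + 1 -> cnak_d i j = 0.
Proof. by move=> ij; rewrite /cnak_d cd_shape // nak_map0. Qed.

Lemma cnak_sq i j k : (cnak_d j k \o cnak_d i j)%VF = 0.
Proof.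
by rewrite -nak_map_comp ?cd_sq ?nak_map0 //; exact: cd_mhom.
Qed.

Definition cnak : cplx := Cplx cnak_mhom cnak_shape cnak_sq.
End Nakayama.

Section Cohomology.
Variables (C : cplx) (i : int).

Lemma cocycles_stable m a :
  m \in lker (cd C i (i + 1)) -> ract m a \in lker (cd C i (i + 1)).
Proof. by rewrite !memv_ker cd_mhom => /eqP->; rewrite ract0. Qed.

Definition cocycles : submod (C i) := Submod cocycles_stable.

Definition cobound : {vspace smod cocycles} :=
  (linfun vsval @^-1: limg (cd C (i - 1) i))%VS.

Lemma cobound_stable m a : m \in cobound -> ract m a \in cobound.
Proof.
rewrite -!memv_preim !lfunE /=.
rewrite vsprojK; last by apply: cocycles_stable; exact: subvsP.
case/memv_imgP => x _ ->; rewrite -cd_mhom.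
exact/memv_img/memvf.
Qed.

Definition cohom : rmodule := qmod (Submod cobound_stable).
End Cohomology.

Definition presilting (U : cplx) :=
  forall l : nat, (1 <= l)%N ->
  forall f : cmap U (shift l U), is_cmap f -> null_homotopic f.

Definition two_term (U : cplx) :=
  exists V : cplx,
    [/\ in_Kb_proj V, forall i : int, i != -1 -> i != 0 -> is_zero (V i) &
        iso_K U V].

Definition indecomposable (U : cplx) :=
  ~ iso_K U czero /\
  forall V W : cplx, in_Kb_proj V -> in_Kb_proj W ->
    iso_K U (cdsum V W) -> iso_K V czero \/ iso_K W czero.

(* No indecomposable direct summand is repeated. *)
Definition basic (U : cplx) :=
  ~ exists V W : cplx,
      [/\ in_Kb_proj V, in_Kb_proj W, indecomposable V &
          iso_K U (cdsum (cdsum V V) W)].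

(* U represents an element of 2-psilt A. *)
Definition two_psilt (U : cplx) :=
  [/\ in_Kb_proj U, two_term U, presilting U & basic U].

Definition H0 (U : cplx) : rmodule := cohom U 0.
Definition Hm1nu (U : cplx) : rmodule := cohom (cnak U) (-1).

Definition Yplus (U Ui : cplx) : rmodule := qmod (rad_trace (H0 U) (H0 Ui)).
Definition Xminus (U Ui : cplx) : rmodule :=
  smod (rad_reject (Hm1nu Ui) (Hm1nu U)).

End Complexes.

Section Grothendieck.
Variables (R : realType) (K : fieldType) (A : falgType K).

(* Projective modules carried by coordinate spaces: a small collection of
   objects that meets every isomorphism class of proj A, see cproj_rep. *)
Record cproj := CProj {
  cproj_dim : nat;
  cproj_act : 'rV[K]_cproj_dim -> A -> 'rV[K]_cproj_dim;
  cproj_actP : is_action cproj_act;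
  cproj_projective : is_projective (RModule cproj_actP) }.

Coercion cproj_mod (P : cproj) : rmodule A := RModule (cproj_actP P).

Lemma iso_projective (P Q : rmodule A) :
  iso_mod P Q -> is_projective P -> is_projective Q.
Proof.
case=> f [g [fA gA gf fg]] PP M N p q pA qA pS.
have [h hA hE] := PP M N p (q \o f)%VF pA (mhom_comp qA fA) pS.
exists (h \o g)%VF; first exact: mhom_comp.
by rewrite comp_lfunA hE -comp_lfunA fg comp_lfun1r.
Qed.

Import VectorInternalTheory.
Lemma cproj_rep (P : rmodule A) :
  is_projective P -> exists Q : cproj, iso_mod P Q.
Proof.
move=> PP; pose act (v : 'rV[K]_(dim P)) (a : A) := v2r (ract (r2v v : P) a).
have actP : is_action act.
  split=> [a k u v|v k a b|v|v a b]; rewrite /act.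
  - by rewrite linearP ract_linearl linearP.
  - by rewrite ract_linearr linearP.
  - by rewrite ract1 r2vK.
  - by rewrite ractM v2rK.
have iso : iso_mod P (RModule actP).
  exists (linfun v2r), (linfun r2v); split.
  - by move=> m a; rewrite !lfunE /= /act v2rK.
  - by move=> m a; rewrite !lfunE /= /act v2rK.
  - by apply/lfunP => m; rewrite comp_lfunE !lfunE /= v2rK.
  - by apply/lfunP => m; rewrite comp_lfunE !lfunE /= r2vK.
by exists (CProj (iso_projective iso PP)).
Qed.

(* Formal real combinations of projective modules. *)
Definition K0_free := FreegDefs.type_of (Phant R) (Phant {classic cproj}).

Definition K0_gen (P : cproj) : K0_free :=
  Freeg [:: (1 : R, P : {classic cproj})].

Definition is_K0_rel (x : K0_free) :=
  exists P Q S : cproj,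
    iso_mod P (mdsum Q S) /\ x = K0_gen P - K0_gen Q - K0_gen S.

(* The real span of the relations [P] = [Q] + [S] for P isomorphic to the
   direct sum of Q and S; this includes [P] = [Q] for isomorphic P and Q. *)
Definition K0_rel : {pred K0_free} := fun x =>
  `[< exists s : seq (R * K0_free),
        (forall rx, rx \in s -> is_K0_rel rx.2) /\
        x = \sum_(rx <- s) rx.1 *: rx.2 >].

Lemma K0_rel_zmod_closed : zmod_closed K0_rel.
Proof.
split; first by apply/asboolP; exists [::]; rewrite big_nil.
move=> x y /asboolP[s [sR ->]] /asboolP[t [tR ->]]; apply/asboolP.
exists (s ++ [seq (- rx.1, rx.2) | rx <- t]); split=> [rx|].
  by rewrite mem_cat => /orP[/sR//|/mapP[ry /tR ? ->]].
rewrite big_cat big_map /= -sumrN; congr (_ + _).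
by apply: eq_bigr => rx _; rewrite scaleNr.
Qed.

HB.instance Definition _ := GRing.isZmodClosed.Build K0_free K0_rel K0_rel_zmod_closed.

Lemma K0_relZ r x : x \in K0_rel -> r *: x \in K0_rel.
Proof.
move=> /asboolP[s [sR ->]]; apply/asboolP.
exists [seq (r * rx.1, rx.2) | rx <- s]; split=> [rx /mapP[ry /sR ? ->] //|].
by rewrite big_map scaler_sumr; apply: eq_bigr => rx _; rewrite scalerA.
Qed.

(* K_0(proj A) tensored with the reals, presented by generators and relations
   over R (tensor products are right exact). *)
Definition K0R := Quotient.quot K0_rel.

HB.instance Definition _ := GRing.Zmodule.on K0R.
HB.instance Definition _ := EqQuotient.on K0R.

Lemma eq_K0R (x y : K0_free) : (pi K0R x = pi K0R y) <-> (x - y \in K0_rel).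
Proof. by rewrite Quotient.idealrBE; split=> [->|/eqP]. Qed.

Definition K0R_scale (r : R) (theta : K0R) : K0R := pi K0R (r *: repr theta).

Lemma K0R_scale_pi r x : K0R_scale r (pi K0R x) = pi K0R (r *: x).
Proof. by apply/eq_K0R; rewrite -scalerBr K0_relZ //; apply/eq_K0R; rewrite reprK. Qed.

Lemma K0R_add_pi x y : pi K0R x + pi K0R y = pi K0R (x + y).
Proof. by rewrite !piE. Qed.

Lemma K0R_piP (theta : K0R) : exists x, theta = pi K0R x.
Proof. by exists (repr theta); rewrite reprK. Qed.

Lemma K0R_scaleA r s theta :
  K0R_scale r (K0R_scale s theta) = K0R_scale (r * s) theta.
Proof. by have [x ->] := K0R_piP theta; rewrite 3!K0R_scale_pi scalerA. Qed.

Lemma K0R_scale1 : left_id 1 K0R_scale.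
Proof. by move=> theta; have [x ->] := K0R_piP theta; rewrite K0R_scale_pi scale1r. Qed.

Lemma K0R_scaleDr : right_distributive K0R_scale +%R.
Proof.
move=> r theta eta; have [x ->] := K0R_piP theta; have [y ->] := K0R_piP eta.
by rewrite K0R_add_pi 3!K0R_scale_pi K0R_add_pi scalerDr.
Qed.

Lemma K0R_scaleDl theta : {morph K0R_scale^~ theta : r s / r + s}.
Proof.
move=> r s; have [x ->] := K0R_piP theta.
by rewrite 3!K0R_scale_pi K0R_add_pi scalerDl.
Qed.

HB.instance Definition _ := GRing.Zmodule_isLmodule.Build R K0R
  K0R_scaleA K0R_scale1 K0R_scaleDr K0R_scaleDl.

(* theta(M) = <theta, [M]>, the R-linear extension of
   <[P], [M]> = dim_K Hom_A(P, M); see eulerE. *)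
Definition euler_free (x : K0_free) (M : rmodule A) : R :=
  fglift (fun P : {classic cproj} => (\dim (homA P M))%:R : R^o) x.

Definition euler (theta : K0R) (M : rmodule A) : R :=
  euler_free (repr theta) M.

Lemma dim_homA_dsum (P Q S M : rmodule A) :
  iso_mod P (mdsum Q S) ->
  \dim (homA P M) = (\dim (homA Q M) + \dim (homA S M))%N.
Proof.
case=> f [g [fA gA gf fg]].
have fE x : g (f x) = x by rewrite -comp_lfunE gf id_lfunE.
have gE x : f (g x) = x by rewrite -comp_lfunE fg id_lfunE.
pose a : 'Hom(P, Q) := linfun (fun x => (f x).1).
pose b : 'Hom(P, S) := linfun (fun x => (f x).2).
pose a' : 'Hom(Q, P) := linfun (fun x => g (x, 0)).
pose b' : 'Hom(S, P) := linfun (fun x => g (0, x)).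
have aE x : a x = (f x).1 by apply: linfunE => k u v; rewrite linearP.
have bE x : b x = (f x).2 by apply: linfunE => k u v; rewrite linearP.
have a'E x : a' x = g (x, 0).
  apply: linfunE => k u v; rewrite -linearP; congr (g _).
  by congr pair; rewrite /= scaler0 addr0.
have b'E x : b' x = g (0, x).
  apply: linfunE => k u v; rewrite -linearP; congr (g _).
  by congr pair; rewrite /= scaler0 addr0.
have aA : is_mhom a by move=> x c; rewrite !aE fA.
have bA : is_mhom b by move=> x c; rewrite !bE fA.
have a'A : is_mhom a'.
  by move=> x c; rewrite !a'E -gA /= /dsum_act /= ract0.
have b'A : is_mhom b'.
  by move=> x c; rewrite !b'E -gA /= /dsum_act /= ract0.
have aa' x : a (a' x) = x by rewrite a'E aE gE.
have bb' x : b (b' x) = x by rewrite b'E bE gE.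
have ab' x : a (b' x) = 0 by rewrite b'E aE gE.
have ba' x : b (a' x) = 0 by rewrite a'E bE gE.
have sumE x : x = a' (a x) + b' (b x).
  rewrite a'E b'E aE bE -linearD -[LHS]fE; congr (g _).
  by case: (f x) => u v; congr pair; rewrite /= ?addr0 ?add0r.
pose F : 'Hom('Hom(Q, M), 'Hom(P, M)) := linfun (fun v => (v \o a)%VF).
pose G : 'Hom('Hom(S, M), 'Hom(P, M)) := linfun (fun v => (v \o b)%VF).
have FE v : F v = (v \o a)%VF.
  by apply: linfunE => k u w; rewrite comp_lfunDl -comp_lfunZl.
have GE v : G v = (v \o b)%VF.
  by apply: linfunE => k u w; rewrite comp_lfunDl -comp_lfunZl.
have Fker : lker F = 0%VS.
  apply/eqP/lker0P => u v /lfunP uv; apply/lfunP => x.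
  by have := uv (a' x); rewrite !FE !comp_lfunE aa'.
have Gker : lker G = 0%VS.
  apply/eqP/lker0P => u v /lfunP uv; apply/lfunP => x.
  by have := uv (b' x); rewrite !GE !comp_lfunE bb'.
have -> : homA P M = (F @: homA Q M + G @: homA S M)%VS.
  apply/vspaceP => u; apply/idP/idP => [/mem_homA uA|].
    apply/memv_addP; exists (F (u \o a')%VF).
      by apply/memv_img/mem_homA; exact: mhom_comp.
    exists (G (u \o b')%VF).
      by apply/memv_img/mem_homA; exact: mhom_comp.
    apply/lfunP => x; rewrite add_lfunE FE GE !comp_lfunE -linearD.
    by rewrite -sumE.
  case/memv_addP => _ /memv_imgP[v /mem_homA vA ->].
  case=> _ /memv_imgP[w /mem_homA wA ->] ->; apply/mem_homA.
  rewrite FE GE -[(v \o a)%VF]scale1r; apply: mhomL; exact: mhom_comp.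
rewrite dimv_disjoint_sum ?limg_dim_eq ?Fker ?Gker ?capv0 //.
apply/eqP; rewrite -subv0; apply/subvP => u /memv_capP[].
case/memv_imgP => v _ uv /memv_imgP[w _ uw]; rewrite memv0; apply/eqP/lfunP => x.
have uF y : u y = v (a y) by rewrite uv FE comp_lfunE.
have uG y : u y = w (b y) by rewrite uw GE comp_lfunE.
by rewrite zero_lfunE [x]sumE linearD /= uG uF ab' ba' !linear0 addr0.
Qed.

Lemma euler_freeB x y M :
  euler_free (x - y) M = euler_free x M - euler_free y M.
Proof. by have := lift_is_additive (M := R^o) (fun P : {classic cproj} => (\dim (homA P M))%:R); exact. Qed.

Lemma euler_free0 M : euler_free 0 M = 0.
Proof. by rewrite -[0](subrr 0) euler_freeB subrr. Qed.

Lemma euler_freeD x y M :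
  euler_free (x + y) M = euler_free x M + euler_free y M.
Proof. by rewrite -{1}[y]opprK -[- y]sub0r !euler_freeB euler_free0 sub0r opprK. Qed.

Lemma euler_free_sum I (s : seq I) (F : I -> K0_free) M :
  euler_free (\sum_(i <- s) F i) M = \sum_(i <- s) euler_free (F i) M.
Proof.
elim: s => [|i s IH]; first by rewrite !big_nil euler_free0.
by rewrite !big_cons euler_freeD IH.
Qed.

Lemma euler_freeZ r x M : euler_free (r *: x) M = r * euler_free x M.
Proof.
rewrite [r *: x]/(fgscale r x) /fgscale.
rewrite -{3}[x]freeg_sumE !euler_free_sum mulr_sumr.
by apply: eq_bigr => P _; rewrite /euler_free !liftU mulrA.
Qed.

Lemma euler_free_gen (P : cproj) M :
  euler_free (K0_gen P) M = (\dim (homA P M))%:R.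
Proof. by rewrite /euler_free liftU scale1r. Qed.

Lemma eulerE (x : K0_free) (M : rmodule A) :
  euler (pi K0R x) M = euler_free x M.
Proof.
apply/eqP; rewrite /euler -subr_eq0 -euler_freeB.
have : repr (pi K0R x) - x \in K0_rel.
  by rewrite Quotient.idealrBE reprK.
case/asboolP => s [sR ->]; rewrite euler_free_sum big_seq big1 // => rx.
case/sR => P [Q [S [/dim_homA_dsum PQS ->]]].
by rewrite euler_freeZ !euler_freeB !euler_free_gen PQS natrD addrAC addrK subrr mulr0.
Qed.

Lemma euler_linear (M : rmodule A) (r : R) (x y : K0R) :
  euler (r *: x + y) M = r * euler x M + euler y M.
Proof.
have [x' ->] := K0R_piP x; have [y' ->] := K0R_piP y.
rewrite [r *: _]K0R_scale_pi K0R_add_pi 3!eulerE.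
by rewrite euler_freeD euler_freeZ.
Qed.

Section Stability.
Variables (theta : K0R) (M : rmodule A).

Definition Tbar := forall N : submod M,
  ~ is_zero (qmod N) -> 0 <= euler theta (qmod N).
Definition Tstab := forall N : submod M,
  ~ is_zero (qmod N) -> 0 < euler theta (qmod N).
Definition Fbar := forall N : submod M,
  ~ is_zero (smod N) -> euler theta (smod N) <= 0.
Definition Fstab := forall N : submod M,
  ~ is_zero (smod N) -> euler theta (smod N) < 0.
End Stability.

Definition Dcone (U : cplx A) : set K0R :=
  [set theta | Tbar theta (H0 U) /\ Fbar theta (Hm1nu U)].

Definition Dcone_open (U : cplx A) : set K0R :=
  [set theta | Tstab theta (H0 U) /\ Fstab theta (Hm1nu U)].

End Grothendieck.

Arguments Dcone R {K A} U.
Arguments Dcone_open R {K A} U.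

(* Main.v *)
Require Import Defs.
From HB Require Import structures.
From mathcomp Require Import all_boot all_order all_algebra all_field.
From mathcomp Require Import boolp classical_sets reals.
From mathcomp Require freeg.

(** The four classes of modules cut out by [theta] have a common shape.  Fix
    a class [Q] of modules that contains the zero modules and is closed under
    extensions; here [Q] consists of the [M] with [M = 0] or [theta(M)] of the
    prescribed sign, and it is closed under extensions because [theta] is
    additive on short exact sequences ([euler_exact], where projectivity
    enters).  Then [M] lies in the torsion class, resp. the torsionfree class,
    exactly when all factors, resp. all submodules, of [M] lie in [Q]
    ([all_factors], [all_subs]), and these classes inherit closure under
    extensions.

    The theorem therefore reduces to a statement on one module [M] which is a
    direct sum of modules [M_i]: all factors of [M] lie in [Q] as soon as the
    same holds for each [M_i / rad(M, M_i) M] ([all_factors_rad_top]), and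
    dually for submodules and common kernels ([all_subs_rad_soc]).  Let [T] be
    a submodule of [M] of largest dimension all of whose factors are in [Q],
    and suppose [T <> M].  The radical [J] of [End M] is nilpotent, so from
    the nonzero projection [p : M -> M / T] one obtains an endomorphism [g]
    with [p g <> 0] and [p g J = 0] ([rad_cosocle]).  On some summand [M_i]
    the map [p g] is not zero, but it kills the images of all radical maps
    [M -> M_i]; its image on [M_i] is thus a nonzero factor of
    [M_i / rad(M, M_i) M], and the preimage of that image in [M] is an
    extension that contradicts the choice of [T].  The nilpotency of [J] is
    Nakayama's lemma for the action of [End M] on the finite dimensional
    space [M] ([rad_family_eq0], [rad_nilpotent]).

    Finally [H^0] and [H^-1 nu] are additive functors that annihilate null
    homotopic maps, so an isomorphism of [U] with the sum of the [U_i] in the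
    homotopy category makes [H^0(U)] and [H^-1(nu U)] direct sums of the
    modules attached to the [U_i] ([hf_sum_of_retracts]). *)

Set Implicit Arguments.
Unset Strict Implicit.
Unset Printing Implicit Defensive.

Import Order.TTheory GRing.Theory Num.Theory.
Local Open Scope classical_set_scope.
Local Open Scope ring_scope.

Local Notation rad := Defs.rad.

(** * Module homomorphisms and classes closed under extensions *)

Section Modules.
Variables (K : fieldType) (A : falgType K).
Implicit Types L M N X Z : rmodule A.

Definition incl M (N : submod M) : 'Hom(smod N, M) := linfun vsval.

Lemma inclE M (N : submod M) v : incl N v = vsval v.
Proof. exact: lfunE. Qed.

Lemma incl_mhom M (N : submod M) : is_mhom (incl N).
Proof. by move=> v a; rewrite !inclE /= vsprojK // svsP // subvsP. Qed.

Lemma lker_incl M (N : submod M) : lker (incl N) = 0%VS.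
Proof. by apply/eqP/lker0P => u v; rewrite !inclE => /val_inj. Qed.

Lemma limg_incl M (N : submod M) : limg (incl N) = N.
Proof.
apply/vspaceP => x; apply/memv_imgP/idP => [[v _ ->]|xN].
  by rewrite inclE subvsP.
by exists (vsproj N x); rewrite ?memvf // inclE vsprojK.
Qed.

Lemma limg_stable M N (f : 'Hom(M, N)) : is_mhom f ->
  forall x a, x \in limg f -> ract x a \in limg f.
Proof.
by move=> fA x a /memv_imgP[y _ ->]; rewrite -fA memv_img ?memvf.
Qed.

Definition im_mod M N (f : 'Hom(M, N)) (fA : is_mhom f) : submod N :=
  Submod (limg_stable fA).

Lemma preim_stable M N (f : 'Hom(M, N)) (S : submod N) : is_mhom f ->
  forall x a, x \in (f @^-1: S)%VS -> ract x a \in (f @^-1: S)%VS.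
Proof. by move=> fA x a; rewrite -!memv_preim fA => /svsP. Qed.

Definition preim_mod M N (f : 'Hom(M, N)) (fA : is_mhom f) (S : submod N) :
  submod M := Submod (preim_stable (S := S) fA).

Lemma zero_stable M x a :
  x \in (0%VS : {vspace M}) -> ract x a \in (0%VS : {vspace M}).
Proof. by rewrite !memv0 => /eqP->; rewrite ract0. Qed.

Definition zero_mod M : submod M := Submod (@zero_stable M).

Lemma full_stable M x a :
  x \in (fullv : {vspace M}) -> ract x a \in (fullv : {vspace M}).
Proof. by rewrite !memvf. Qed.

Definition full_mod M : submod M := Submod (@full_stable M).

Lemma mem_lkerE M N (f : 'Hom(M, N)) x : (x \in lker f) <-> f x = 0.
Proof. by rewrite memv_ker; split=> /eqP. Qed.

Lemma inj_lfun M N (f : 'Hom(M, N)) x : lker f = 0%VS -> f x = 0 -> x = 0.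
Proof. by move=> f0 /mem_lkerE; rewrite f0 memv0 => /eqP. Qed.

(** The kernel property of a monomorphism: the partial inverse of [f] serves
    as a left inverse on its image, and injectivity of [f] makes the lift
    [A]-linear. *)
Lemma lift_mono L M X (f : 'Hom(L, M)) (k : 'Hom(X, M)) :
  is_mhom f -> is_mhom k -> lker f = 0%VS -> (limg k <= limg f)%VS ->
  exists2 k' : 'Hom(X, L), is_mhom k' & forall x, f (k' x) = k x.
Proof.
move=> fA kA f0 /subvP kf.
have fk x : f (((f^-1)%VF \o k)%VF x) = k x.
  by rewrite comp_lfunE limg_lfunVK // kf // memv_img ?memvf.
exists ((f^-1)%VF \o k)%VF => // x a.
by apply: (lker0P (introT eqP f0)); rewrite fA !fk kA.
Qed.

(** The cokernel property of an epimorphism: maps that kill the kernel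
    descend along it. *)
Lemma ext_epi M N X (g : 'Hom(M, N)) (k : 'Hom(M, X)) :
  is_mhom g -> is_mhom k -> limg g = fullv -> (lker g <= lker k)%VS ->
  exists2 k' : 'Hom(N, X), is_mhom k' & forall x, k' (g x) = k x.
Proof.
move=> gA kA gT /subvP gk.
have kg x : (k \o g^-1)%VF (g x) = k x.
  rewrite comp_lfunE; apply/eqP; rewrite -subr_eq0 -linearB /= -memv_ker.
  apply: gk; rewrite memv_ker linearB /= limg_lfunVK ?subrr //.
  by rewrite memv_img ?memvf.
exists (k \o g^-1)%VF => // y a.
have /memv_imgP[x _ ->] : y \in limg g by rewrite gT memvf.
by rewrite -gA !kg kA.
Qed.

Lemma corestrict M N (f : 'Hom(M, N)) (fA : is_mhom f) :
  exists k : 'Hom(M, smod (im_mod fA)),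
    [/\ is_mhom k, forall x, incl (im_mod fA) (k x) = f x & limg k = fullv].
Proof.
have fS : (limg f <= limg (incl (im_mod fA)))%VS by rewrite limg_incl.
have [k kA kE] := lift_mono (@incl_mhom _ (im_mod fA)) fA (lker_incl _) fS.
exists k; split=> //; apply/vspaceP => s; rewrite memvf; apply/memv_imgP.
have /memv_imgP[x _ sx] : incl (im_mod fA) s \in limg f.
  by rewrite inclE subvsP.
exists x; first exact: memvf.
by apply: (lker0P (introT eqP (lker_incl (im_mod fA)))); rewrite kE.
Qed.

Definition exact3 L M N (f : 'Hom(L, M)) (g : 'Hom(M, N)) :=
  [/\ is_mhom f, is_mhom g, lker f = 0%VS, limg f = lker g & limg g = fullv].

Lemma exact3_incl_qproj M (S : submod M) : exact3 (incl S) (qproj S).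
Proof.
split; [exact: incl_mhom | exact: qproj_mhom | exact: lker_incl | |
  exact: qproj_surj].
by rewrite limg_incl lker_qproj.
Qed.

(** Closure under isomorphism is a consequence, see [ext_closed_iso]. *)
Definition ext_closed (Q : rmodule A -> Prop) :=
  (forall X, is_zero X -> Q X) /\
  (forall L M N (f : 'Hom(L, M)) (g : 'Hom(M, N)),
    exact3 f g -> Q L -> Q N -> Q M).

Lemma mzero_is_zero : is_zero (mzero A).
Proof.
by apply/vspaceP => x; rewrite memvf memv0; apply/esym/eqP/rowP; case.
Qed.

Section Classes.
Variable Q : rmodule A -> Prop.
Hypothesis Qext : ext_closed Q.

(** An isomorphism is a short exact sequence with last term zero. *)
Lemma ext_closed_iso L M (f : 'Hom(L, M)) :
  is_mhom f -> lker f = 0%VS -> limg f = fullv -> Q L -> Q M.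
Proof.
move=> fA f0 fT QL; case: Qext => Q0 Qe.
apply: (Qe _ _ _ f (0 : 'Hom(M, mzero A))) => //; last exact/Q0/mzero_is_zero.
split=> //; first exact: mhom0.
  by rewrite fT; apply/vspaceP => x; rewrite memvf memv_ker zero_lfunE eqxx.
by rewrite mzero_is_zero; apply/eqP; rewrite -subv0 -mzero_is_zero subvf.
Qed.

Definition all_factors M :=
  forall X (f : 'Hom(M, X)), is_mhom f -> limg f = fullv -> Q X.

Definition all_subs M :=
  forall X (f : 'Hom(X, M)), is_mhom f -> lker f = 0%VS -> Q X.

(** Up to isomorphism every factor is a quotient by a submodule, which
    connects the map-based classes below with the submodule-based
    definitions of the stability classes. *)
Lemma all_factorsE M : all_factors M <-> forall N : submod M, Q (qmod N).
Proof.
split=> [MQ N|MQ X f fA fT].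
  by apply: (MQ _ (qproj N)); [exact: qproj_mhom | exact: qproj_surj].
pose N := preim_mod fA (zero_mod X).
have NE x : (x \in svs N) <-> f x = 0.
  by rewrite -memv_preim memv0; split=> /eqP.
have qT := qproj_surj N.
have Nf : (lker (qproj N) <= lker f)%VS.
  by apply/subvP => x; rewrite lker_qproj => /NE/mem_lkerE.
have [h hA hE] := ext_epi (@qproj_mhom _ _ _ N) fA qT Nf.
apply: (ext_closed_iso hA) (MQ N).
  apply/eqP; rewrite -subv0; apply/subvP => y /mem_lkerE.
  have /memv_imgP[x _ ->] : y \in limg (qproj N) by rewrite qT memvf.
  by rewrite hE memv0 => /NE; rewrite -lker_qproj => /mem_lkerE ->.
apply/eqP; rewrite eqEsubv subvf -fT; apply/subvP => _ /memv_imgP[x _ ->].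
by rewrite -hE memv_img ?memvf.
Qed.

Lemma all_subsE M : all_subs M <-> forall N : submod M, Q (smod N).
Proof.
split=> [MQ N|MQ X f fA f0].
  by apply: (MQ _ (incl N)); [exact: incl_mhom | exact: lker_incl].
have [h hA hE] : exists2 h : 'Hom(smod (im_mod fA), X), is_mhom h &
    forall x, f (h x) = incl (im_mod fA) x.
  by apply: lift_mono => //; [exact: incl_mhom | rewrite limg_incl].
apply: (ext_closed_iso hA) (MQ _).
  apply/eqP; rewrite -subv0; apply/subvP => y /mem_lkerE hy; rewrite memv0.
  by apply/eqP/(inj_lfun (lker_incl _)); rewrite -hE hy linear0.
apply/vspaceP => x; rewrite memvf; apply/memv_imgP.
have /memv_imgP[y _ fxy] : f x \in limg (incl (im_mod fA)).
  by rewrite limg_incl memv_img ?memvf.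
exists y; first exact: memvf.
by apply: (lker0P (introT eqP f0)); rewrite hE.
Qed.

Lemma all_factors_epi M N (f : 'Hom(M, N)) :
  is_mhom f -> limg f = fullv -> all_factors M -> all_factors N.
Proof.
move=> fA fT MQ X g gA gT; apply: (MQ _ (g \o f)%VF); first exact: mhom_comp.
by rewrite limg_comp fT.
Qed.

Lemma all_subs_mono M N (f : 'Hom(N, M)) :
  is_mhom f -> lker f = 0%VS -> all_subs M -> all_subs N.
Proof.
move=> fA f0 MQ X g gA g0; apply: (MQ _ (f \o g)%VF); first exact: mhom_comp.
apply/eqP; rewrite -subv0; apply/subvP => x /mem_lkerE; rewrite comp_lfunE.
by move=> /(inj_lfun f0)/(inj_lfun g0) ->; rewrite mem0v.
Qed.

(** A factor [X] of the middle term is an extension of a factor of the last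
    term by the image of the first term in [X]. *)
Lemma all_factors_ext L M N (f : 'Hom(L, M)) (g : 'Hom(M, N)) :
  exact3 f g -> all_factors L -> all_factors N -> all_factors M.
Proof.
case=> fA gA f0 fg gT LQ NQ X h hA hT.
have hfA : is_mhom (h \o f)%VF by exact: mhom_comp.
pose S := im_mod hfA.
case: Qext => _; apply; first exact: (exact3_incl_qproj S).
- by have [k [kA _ kT]] := corestrict hfA; exact: (LQ _ k).
- have gS : (lker g <= lker (qproj S \o h))%VS.
    rewrite -fg; apply/subvP => _ /memv_imgP[x _ ->]; apply/mem_lkerE.
    rewrite comp_lfunE; apply/mem_lkerE; rewrite lker_qproj /=.
    by rewrite -comp_lfunE memv_img ?memvf.
  have [k kA kE] := ext_epi gA (mhom_comp (@qproj_mhom _ _ _ S) hA) gT gS.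
  apply: (NQ _ k) => //; apply/eqP; rewrite eqEsubv subvf -(qproj_surj S).
  apply/subvP => _ /memv_imgP[x _ ->].
  have /memv_imgP[y _ ->] : x \in limg h by rewrite hT memvf.
  by rewrite -comp_lfunE -kE memv_img ?memvf.
Qed.

(** A submodule [X] of the middle term is an extension of its image in the
    last term by its intersection with the first term. *)
Lemma all_subs_ext L M N (f : 'Hom(L, M)) (g : 'Hom(M, N)) :
  exact3 f g -> all_subs L -> all_subs N -> all_subs M.
Proof.
case=> fA gA f0 fg gT LQ NQ X h hA h0.
have ghA : is_mhom (g \o h)%VF by exact: mhom_comp.
pose S := preim_mod ghA (zero_mod N).
have SE x : (x \in svs S) <-> g (h x) = 0.
  by rewrite -memv_preim memv0 comp_lfunE; split=> /eqP.
case: Qext => _; apply; first exact: (exact3_incl_qproj S).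
- have Sf : (limg (h \o incl S) <= limg f)%VS.
    rewrite fg; apply/subvP => _ /memv_imgP[x _ ->]; apply/mem_lkerE.
    by rewrite comp_lfunE; apply/SE; rewrite inclE subvsP.
  have [k kA kE] := lift_mono fA (mhom_comp hA (@incl_mhom _ S)) f0 Sf.
  apply: (LQ _ k) => //; apply/eqP; rewrite -subv0.
  apply/subvP => x /mem_lkerE kx; rewrite memv0.
  apply/eqP/(inj_lfun (lker_incl S))/(inj_lfun h0).
  by rewrite -comp_lfunE -kE kx linear0.
- have Sgh : (lker (qproj S) <= lker (g \o h))%VS.
    rewrite lker_qproj; apply/subvP => x /SE gx.
    by apply/mem_lkerE; rewrite comp_lfunE.
  have [k kA kE] := ext_epi (@qproj_mhom _ _ _ S) ghA (qproj_surj S) Sgh.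
  apply: (NQ _ k) => //; apply/eqP; rewrite -subv0; apply/subvP => y /mem_lkerE.
  have /memv_imgP[x _ ->] : y \in limg (qproj S) by rewrite qproj_surj memvf.
  rewrite kE comp_lfunE memv0 => /SE; rewrite -(lker_qproj S) => /mem_lkerE ->.
  exact: eqxx.
Qed.

End Classes.
End Modules.

(** * The radical of an endomorphism ring is nilpotent *)

Section Radical.
Variables (K : fieldType) (A : falgType K).
Implicit Types L M N X Z : rmodule A.

Lemma mhomD M N (f g : 'Hom(M, N)) : is_mhom f -> is_mhom g -> is_mhom (f + g).
Proof. by move=> fA gA; rewrite -[f]scale1r; exact: mhomL. Qed.

Lemma mhomB M N (f g : 'Hom(M, N)) : is_mhom f -> is_mhom g -> is_mhom (f - g).
Proof. by move=> fA gA; rewrite addrC -scaleN1r; exact: mhomL. Qed.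

Lemma is_autoP M (f : 'End(M)) : is_auto f <->
  is_mhom f /\ exists2 g : 'End(M), is_mhom g & cancel f g /\ cancel g f.
Proof.
split=> [[g [fA gA gf fg]]|[fA [g gA [fK gK]]]].
  split=> //; exists g => //; split=> x.
    by rewrite -comp_lfunE gf id_lfunE.
  by rewrite -comp_lfunE fg id_lfunE.
by exists g; split=> //; apply/lfunP => x; rewrite comp_lfunE id_lfunE ?fK ?gK.
Qed.

Lemma is_auto_comp M (f g : 'End(M)) :
  is_auto f -> is_auto g -> is_auto (f \o g)%VF.
Proof.
move=> /is_autoP[fA [f' f'A [fK f'K]]] /is_autoP[gA [g' g'A [gK g'K]]].
apply/is_autoP; split; first exact: mhom_comp.
exists (g' \o f')%VF; first exact: mhom_comp.
by split=> x; rewrite !comp_lfunE /= ?fK ?gK ?g'K ?f'K.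
Qed.

Lemma one_subE M N (f : 'Hom(M, N)) (g : 'Hom(N, M)) x :
  (\1 - (g \o f))%VF x = x - g (f x).
Proof. by rewrite add_lfunE opp_lfunE id_lfunE comp_lfunE. Qed.

(** The classical identity: if [u] is inverse to [1 - f g], then [1 + g u f]
    is inverse to [1 - g f]. *)
Lemma is_auto_1subC M N (f : 'Hom(M, N)) (g : 'Hom(N, M)) :
  is_mhom f -> is_mhom g ->
  is_auto (\1 - (f \o g))%VF -> is_auto (\1 - (g \o f))%VF.
Proof.
move=> fA gA /is_autoP[_ [u uA [uK Ku]]]; apply/is_autoP; split.
  by apply: mhomB; [exact: mhom_id | exact: mhom_comp].
exists (\1 + (g \o (u \o f)))%VF.
  by apply: mhomD; [exact: mhom_id | do !apply: mhom_comp].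
have EK x : (\1 + (g \o (u \o f)))%VF x = x + g (u (f x)).
  by rewrite add_lfunE id_lfunE !comp_lfunE.
split=> x; rewrite EK one_subE.
- have := uK (f x); rewrite one_subE linearB /= => E.
  by rewrite [f (x - _)]linearB [u (_ - _)]linearB /= E subrK.
- have := Ku (f x); rewrite one_subE => E.
  have -> : f (x + g (u (f x))) = u (f x) by rewrite linearD /= -{1}E subrK.
  by rewrite addrK.
Qed.

Lemma rad_compl M N X (f : 'Hom(M, N)) (h : 'Hom(N, X)) :
  rad f -> is_mhom h -> rad (h \o f)%VF.
Proof.
move=> [fA fR] hA; split=> [|g gA]; first exact: mhom_comp.
by rewrite comp_lfunA; apply: fR; exact: mhom_comp.
Qed.

Lemma rad_compr M N X (f : 'Hom(M, N)) (h : 'Hom(X, M)) :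
  rad f -> is_mhom h -> rad (f \o h)%VF.
Proof.
move=> [fA fR] hA; split=> [|g gA]; first exact: mhom_comp.
rewrite comp_lfunA; apply: is_auto_1subC => //; first exact: mhom_comp.
by rewrite comp_lfunA; apply: fR; exact: mhom_comp.
Qed.

Lemma rad0 M N : rad (0 : 'Hom(M, N)).
Proof.
split=> [|g gA]; first exact: mhom0.
rewrite comp_lfun0r subr0; apply/is_autoP; split; first exact: mhom_id.
by exists \1%VF; [exact: mhom_id | split=> x; rewrite !id_lfunE].
Qed.

(** With [v] inverse to [1 - g f], one has [1 - g (f + f') = (1 - g f) (1 -
    v g f')], a product of automorphisms. *)
Lemma radD M N (f f' : 'Hom(M, N)) : rad f -> rad f' -> rad (f + f').
Proof.
move=> [fA fR] [f'A f'R]; split=> [|g gA]; first exact: mhomD.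
have /is_autoP[uA [v vA [uK vK]]] := fR g gA.
have -> : (\1 - (g \o (f + f')) =
    (\1 - (g \o f)) \o (\1 - ((v \o g) \o f')))%VF.
  apply/lfunP => x; rewrite [RHS]comp_lfunE [X in _ = _ X]one_subE.
  rewrite linearB /= comp_lfunE vK !one_subE.
  by rewrite add_lfunE linearD opprD addrA.
by apply: is_auto_comp; [exact: fR | apply: f'R; exact: mhom_comp].
Qed.

Lemma radZ M N k (f : 'Hom(M, N)) : rad f -> rad (k *: f).
Proof.
move=> fR; rewrite -[f]comp_lfun1l comp_lfunZl; apply: rad_compl => //.
by rewrite -[k *: _]addr0; apply: mhomL; [exact: mhom_id | exact: mhom0].
Qed.

(** Nakayama's lemma in the form of a linear system. The first equation
    reads [(1 - f_0) w_0 = ...] with [1 - f_0] invertible, so that [w_0] can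
    be eliminated; the system for the remaining entries again has
    coefficients in the radical. *)
Lemma rad_family_eq0 M r (w : 'I_r -> M) :
  (forall i, exists2 f : 'I_r -> 'End(M), (forall j, rad (f j : 'Hom(M, M))) &
     w i = \sum_j f j (w j)) ->
  forall i, w i = 0.
Proof.
elim: r w => [|r IH] w wJ; first by case.
have [f0 f0R w0] := wJ ord0; move: w0; rewrite big_ord_recl /= => w0.
have [_ /(_ \1%VF (@mhom_id _ _ _))] := f0R ord0.
rewrite comp_lfun1l => /is_autoP[_ [u uA [uK _]]].
(* Since u inverts 1 - f0 ord0, the h j express w ord0 through the other
   entries. *)
pose h j := (u \o f0 (lift ord0 j))%VF.
have hR j : rad (h j) by exact: rad_compl.
have {}w0 : w ord0 = \sum_j h j (w (lift ord0 j)).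
  rewrite -[LHS]uK !lfun_simp /= {1}w0 addrAC subrr add0r linear_sum /=.
  by apply: eq_bigr => j _; rewrite comp_lfunE.
have wl j : w (lift ord0 j) = 0.
  apply: (IH (fun j => w (lift ord0 j))) => {}j.
  have [f fR ->] := wJ (lift ord0 j).
  exists (fun l => (f ord0 \o h l) + f (lift ord0 l))%VF => [l|].
    by apply: radD => //; apply: rad_compl; rewrite ?hR //; case: (fR ord0).
  rewrite big_ord_recl /= {1}w0 linear_sum -big_split /=.
  by apply: eq_bigr => l _; rewrite !lfun_simp.
move=> i; case: (unliftP ord0 i) => [j|] ->; first exact: wl.
by rewrite w0 big1 // => j _; rewrite wl linear0.
Qed.

Fixpoint rad_word M (n : nat) (g : 'End(M)) : Prop :=
  if n is n'.+1 then
    exists f g' : 'End(M),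
      [/\ rad (f : 'Hom(M, M)), rad_word n' g' & g = (f \o g')%VF]
  else g = \1%VF.

Lemma rad_word_mhom M n (g : 'End(M)) : rad_word n g -> is_mhom g.
Proof.
elim: n g => [|n IH] g /=; first by move=> ->; exact: mhom_id.
by case=> f [g' [[fA _] /IH g'A ->]]; exact: mhom_comp.
Qed.

(** The recursion extends a word on the left, as for the socle of
    [Hom(X, M)]; the socle of [Hom(M, X)] needs extension on the right. *)
Lemma rad_wordSr M n (g f : 'End(M)) :
  rad_word n g -> rad (f : 'Hom(M, M)) -> rad_word n.+1 (g \o f)%VF.
Proof.
elim: n g => [|n IH] g /=.
  move=> -> fR; exists f, \1%VF; split=> //.
  by rewrite comp_lfun1l comp_lfun1r.
case=> f' [g' [f'R /IH g'W ->]] /g'W fg'; exists f', (g' \o f)%VF; split=> //.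
by rewrite comp_lfunA.
Qed.

(** Splitting off the rightmost factor shows that [J^n M] decreases in [n]. *)
Lemma rad_wordS_inv M n (g : 'End(M)) : rad_word n.+1 g ->
  exists f g' : 'End(M),
    [/\ rad (f : 'Hom(M, M)), rad_word n g' & g = (g' \o f)%VF].
Proof.
elim: n g => [|n IH] g /=.
  by case=> f [_ [fR -> ->]]; exists f, \1%VF; rewrite comp_lfun1l comp_lfun1r.
case=> f [g' [fR /IH[f' [g'' [f'R g''W ->]]] ->]].
exists f', (f \o g'')%VF; split=> //; last by rewrite comp_lfunA.
by exists f, g''.
Qed.

(** The subspace [J^n M], where [J] is the radical of [End M]. *)
Definition rad_pow M n : {vspace M} :=
  vspan [set y | exists g x, rad_word n g /\ y = g x].

Lemma rad_pow_decr M n : (rad_pow M n.+1 <= rad_pow M n)%VS.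
Proof.
apply: vspan_subv => _ [g [x [/rad_wordS_inv[f [g' [_ g'W ->]]] ->]]].
by apply: mem_vspan; exists g', (f x); rewrite comp_lfunE.
Qed.

(** If [J W = W], then a basis of [W] satisfies a linear system with
    coefficients in [J], hence vanishes. *)
Lemma rad_pow_stuck M n : rad_pow M n.+1 = rad_pow M n -> rad_pow M n = 0%VS.
Proof.
set W := rad_pow M n => WE.
pose r := \dim W; pose w (i : 'I_r) := (vbasis W)`_i.
pose S : set M := [set v | exists2 f : 'I_r -> 'End(M),
  (forall j, rad (f j : 'Hom(M, M))) & v = \sum_j f j (w j)].
have SE := @vspanE _ _ S.
have S0 : S 0.
  exists (fun=> 0) => [j|]; first exact: rad0.
  by rewrite big1 // => j _; rewrite zero_lfunE.
have SL k u v : S u -> S v -> S (k *: u + v).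
  case=> f fR -> [g gR ->]; exists (fun j => k *: f j + g j) => [j|].
    by apply: radD => //; exact: radZ.
  rewrite scaler_sumr -big_split; apply: eq_bigr => j _.
  by rewrite !lfun_simp.
have WS v : v \in W -> S v.
  rewrite -WE => vW; apply/(SE S0 SL); move: v vW; apply/subvP.
  apply: vspan_subv => _ [_ [x [[f [g [fR gW ->]]] ->]]].
  apply: mem_vspan.
  have gx : g x \in W by apply: mem_vspan; exists g, x.
  exists (fun j => coord (vbasis W) j (g x) *: f) => [j|]; first exact: radZ.
  rewrite comp_lfunE [in LHS](coord_vbasis gx) linear_sum.
  by apply: eq_bigr => j _; rewrite linearZ /= !lfun_simp.
have w0 : forall i, w i = 0.
  apply: rad_family_eq0 => i; apply: WS.
  by apply: vbasis_mem; rewrite mem_nth ?size_tuple.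
apply/eqP; rewrite -subv0; apply/subvP => v /coord_vbasis ->.
by rewrite memv0 big1 // => i _; rewrite -/(w i) w0 scaler0.
Qed.

Lemma rad_nilpotent M : exists n, forall g : 'End(M), rad_word n g -> g = 0.
Proof.
have dimW n : (\dim (rad_pow M n) <= \dim {:M} - n)%N.
  elim: n => [|n IH]; first by rewrite subn0 dimvS ?subvf.
  have [/eqP E|NE] := boolP (rad_pow M n.+1 == rad_pow M n).
    by rewrite E rad_pow_stuck // dimv0.
  have : (\dim (rad_pow M n.+1) < \dim (rad_pow M n))%N.
    rewrite ltnNge; apply: contra NE => le.
    by rewrite eqEdim rad_pow_decr.
  move=> lt; rewrite subnS -ltnS; apply: leq_trans lt _.
  by apply: leq_trans IH _; exact: leqSpred.
exists (\dim {:M}) => g gW; apply/lfunP => x.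
have : g x \in rad_pow M (\dim {:M}) by apply: mem_vspan; exists g, x.
have := dimW (\dim {:M}); rewrite subnn leqn0 dimv_eq0 => /eqP ->.
by rewrite memv0 zero_lfunE => /eqP.
Qed.

(** The right [End M]-module [Hom(M, X)] has an essential socle: multiply
    [p] by a word of maximal length that does not annihilate it. *)
Lemma rad_cosocle M X (p : 'Hom(M, X)) : p != 0 ->
  exists g : 'End(M), [/\ is_mhom g, (p \o g)%VF != 0 &
    forall f : 'End(M), rad (f : 'Hom(M, M)) -> ((p \o g) \o f)%VF = 0].
Proof.
move=> p0; have [n nil] := rad_nilpotent M.
have : forall g : 'End(M), rad_word n g -> (p \o g)%VF = 0.
  by move=> g /nil ->; rewrite comp_lfun0r.
(* Decrease n as long as all words of length n annihilate p; words of
   length 0 do not. *)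
elim: n {nil} => [/(_ \1%VF erefl)/eqP|n IH pn].
  by rewrite comp_lfun1r (negPf p0).
have [/IH//|/existsNP[g /not_implyP[gW /eqP pg]]] :=
  pselect (forall g : 'End(M), rad_word n g -> (p \o g)%VF = 0).
exists g; split=> // [|f fR]; first exact: rad_word_mhom gW.
by rewrite -comp_lfunA; apply: pn; exact: rad_wordSr.
Qed.

(** The dual of [rad_cosocle], for the left [End M]-module [Hom(X, M)]. *)
Lemma rad_socle M X (p : 'Hom(X, M)) : p != 0 ->
  exists g : 'End(M), [/\ is_mhom g, (g \o p)%VF != 0 &
    forall f : 'End(M), rad (f : 'Hom(M, M)) -> (f \o (g \o p))%VF = 0].
Proof.
move=> p0; have [n nil] := rad_nilpotent M.
have : forall g : 'End(M), rad_word n g -> (g \o p)%VF = 0.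
  by move=> g /nil ->; rewrite comp_lfun0l.
(* Decrease n as long as all words of length n annihilate p; words of
   length 0 do not. *)
elim: n {nil} => [/(_ \1%VF erefl)/eqP|n IH pn].
  by rewrite comp_lfun1l (negPf p0).
have [/IH//|/existsNP[g /not_implyP[gW /eqP pg]]] :=
  pselect (forall g : 'End(M), rad_word n g -> (g \o p)%VF = 0).
exists g; split=> // [|f fR]; first exact: rad_word_mhom gW.
by rewrite comp_lfunA; apply: pn; exists f, g.
Qed.

End Radical.

(** * Top and socle with respect to the radical *)

Section RadicalTop.
Variables (K : fieldType) (A : falgType K).
Implicit Types L M N X Z : rmodule A.

(** A direct sum decomposition recorded by the idempotent endomorphisms [e i]
    and their splittings.  Unlike the splittings, the [e i] form a
    non-dependent family, so they can be summed and defined by cases on [i]. *)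
Definition sum_of_retracts (I : finType) M (M_ : I -> rmodule A) :=
  exists e : I -> 'End(M),
    (forall x, x = \sum_i e i x) /\
    forall i, exists (p : 'Hom(M, M_ i)) (q : 'Hom(M_ i, M)),
      [/\ is_mhom p, is_mhom q, (p \o q)%VF = \1%VF & e i = (q \o p)%VF].

Lemma bounded_max (P : nat -> Prop) b : (exists n, P n) ->
  (forall n, P n -> (n <= b)%N) -> exists2 n, P n & forall k, P k -> (k <= n)%N.
Proof.
move=> exP leP; have exP' : exists n, `[< P n >].
  by case: exP => n Pn; exists n; apply/asboolP.
have leP' n : `[< P n >] -> (n <= b)%N by move=> /asboolP/leP.
case: (ex_maxnP exP' leP') => n /asboolP Pn max; exists n => // k Pk.
by apply/max/asboolP.
Qed.

Variables (Q : rmodule A -> Prop) (Qext : ext_closed Q).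
Variables (I : finType) (M : rmodule A) (M_ : I -> rmodule A).
Hypothesis Mret : sum_of_retracts M M_.

Lemma zero_mod_is_zero N (S : submod N) : svs S = 0%VS -> is_zero (smod S).
Proof.
move=> S0; apply/eqP; rewrite -subv0; apply/subvP => x _; rewrite memv0.
apply/eqP/(inj_lfun (lker_incl S)); apply/eqP; rewrite -memv0 -S0.
by rewrite inclE subvsP.
Qed.

Lemma full_mod_is_zero N (S : submod N) : svs S = fullv -> is_zero (qmod S).
Proof.
move=> ST; apply/eqP; rewrite -subv0; apply/subvP => x _.
have /memv_imgP[y _ ->] : x \in limg (qproj S) by rewrite qproj_surj memvf.
have /mem_lkerE -> : y \in lker (qproj S) by rewrite lker_qproj ST memvf.
by rewrite mem0v.
Qed.

Lemma all_factors_zero N : is_zero N -> all_factors Q N.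
Proof.
move=> N0 X f fA fT; case: Qext => + _; apply.
by rewrite /is_zero -fT N0 limg0.
Qed.

Lemma all_subs_zero N : is_zero N -> all_subs Q N.
Proof.
move=> N0 X f fA f0; case: Qext => + _; apply.
apply/eqP; rewrite -subv0; apply/subvP => x _; rewrite memv0.
by apply/eqP/(inj_lfun f0)/eqP; rewrite -memv0 -N0 memvf.
Qed.

(** Otherwise a submodule of largest dimension with all factors in [Q] could
    be enlarged by a nonzero factor of some [M_ i / rad(M, M_ i) M]. *)
Theorem all_factors_of_rad_trace :
  (forall i, all_factors Q (qmod (rad_trace M (M_ i)))) -> all_factors Q M.
Proof.
move=> YQ.
have [||n [T TQ Tn] Tmax] := @bounded_max
    (fun n => exists2 T : submod M, all_factors Q (smod T) & \dim T = n)
    (\dim {:M}).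
- exists (\dim (zero_mod M)), (zero_mod M) => //.
  by apply/all_factors_zero/zero_mod_is_zero.
- by move=> _ [T _ <-]; rewrite dimvS ?subvf.
have [TT|TN] := eqVneq (svs T) fullv.
  by apply: all_factors_epi (@incl_mhom _ _ _ T) _ TQ; rewrite limg_incl.
pose p := qproj T; have pA : is_mhom p := @qproj_mhom _ _ _ T.
have /rad_cosocle[g [gA pg0 pgJ]] : p != 0.
  apply: contraNneq TN => p0; apply/eqP/vspaceP => x.
  by rewrite -[in LHS]lker_qproj -/p p0 memv_ker zero_lfunE eqxx memvf.
case: Mret => e [e1 eR].
have [i pge] : exists i, ((p \o g) \o e i)%VF != 0.
  apply: contrapT => no; move/eqP: pg0; apply; apply/lfunP => x.
  rewrite (e1 x) linear_sum zero_lfunE big1 // => i _.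
  have [/eqP E|NE] := boolP (((p \o g) \o e i)%VF == 0).
    by rewrite /= -comp_lfunE E zero_lfunE.
  by case: no; exists i.
have [a [b [aA bA ab eE]]] := eR i.
pose k := ((p \o g) \o b)%VF.
have kA : is_mhom k by do !apply: mhom_comp.
have k0 : k != 0.
  apply: contraNneq pge => k0.
  by rewrite eE comp_lfunA -/k k0 comp_lfun0l.
pose S0 := im_mod kA.
have S0Q : all_factors Q (smod S0).
  have [k' [k'A k'E k'T]] := corestrict kA.
  have Rk' : (lker (qproj (rad_trace M (M_ i))) <= lker k')%VS.
    rewrite lker_qproj; apply: vspan_subv => _ [f [fR [x ->]]].
    apply/mem_lkerE/(inj_lfun (lker_incl S0)); rewrite k'E -comp_lfunE.
    by rewrite /k -comp_lfunA pgJ ?zero_lfunE //; exact: rad_compl.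
  have [h hA hE] :=
    ext_epi (@qproj_mhom _ _ _ (rad_trace M (M_ i))) k'A (qproj_surj _) Rk'.
  apply: all_factors_epi hA _ (YQ i).
  apply/eqP; rewrite eqEsubv subvf -k'T; apply/subvP => _ /memv_imgP[x _ ->].
  by rewrite -hE memv_img ?memvf.
pose S := preim_mod pA S0.
have SE x : (x \in svs S) = (p x \in limg k) by rewrite -memv_preim.
have TS : (T <= S)%VS.
  apply/subvP => x xT; have /mem_lkerE px : x \in lker p by rewrite lker_qproj.
  by rewrite SE px mem0v.
have iST : (limg (incl T) <= limg (incl S))%VS by rewrite !limg_incl.
have [j jA jE] :=
  lift_mono (@incl_mhom _ _ _ S) (@incl_mhom _ _ _ T) (lker_incl S) iST.
have pS : (limg (p \o incl S) <= limg (incl S0))%VS.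
  rewrite limg_incl; apply/subvP => _ /memv_imgP[x _ ->].
  have : incl S x \in svs S by rewrite inclE subvsP.
  by rewrite SE comp_lfunE.
have [q qA qE] := lift_mono (@incl_mhom _ _ _ S0)
  (mhom_comp pA (@incl_mhom _ _ _ S)) (lker_incl S0) pS.
have jq : exact3 j q.
  split=> //.
  - apply/eqP; rewrite -subv0; apply/subvP => x /mem_lkerE jx; rewrite memv0.
    by apply/eqP/(inj_lfun (lker_incl T)); rewrite -jE jx linear0.
  - apply/vspaceP => x; apply/memv_imgP/idP => [[y _ ->]|/mem_lkerE qx].
      apply/mem_lkerE/(inj_lfun (lker_incl S0)); rewrite qE comp_lfunE jE.
      by apply/mem_lkerE; rewrite lker_qproj inclE subvsP.
    have : incl S x \in limg (incl T).
      rewrite limg_incl -(lker_qproj T); apply/mem_lkerE.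
      by rewrite -comp_lfunE -qE qx linear0.
    case/memv_imgP => y _ xy; exists y; first exact: memvf.
    by apply: (lker0P (introT eqP (lker_incl S))); rewrite jE.
  - apply/vspaceP => s; rewrite memvf; apply/memv_imgP.
    have sk : incl S0 s \in limg k by rewrite inclE subvsP.
    have /memv_imgP[x _ px] : incl S0 s \in limg p by rewrite qproj_surj memvf.
    have : x \in limg (incl S) by rewrite limg_incl SE -px.
    case/memv_imgP => y _ xy; exists y; first exact: memvf.
    apply: (lker0P (introT eqP (lker_incl S0))).
    by rewrite qE comp_lfunE -xy.
(* The preimage S of S0 is an extension of S0 by T, so maximality gives
   S = T, that is k = 0. *)
have := Tmax (\dim S) (ex_intro2 _ _ S (all_factors_ext Qext jq TQ S0Q) erefl).
rewrite -Tn => ST.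
have {}ST : svs S = svs T by apply/esym/eqP; rewrite eqEdim TS.
case/eqP: k0; apply/lfunP => x; rewrite zero_lfunE.
have /memv_imgP[y _ ky] : k x \in limg p by rewrite qproj_surj memvf.
rewrite ky; apply/mem_lkerE; rewrite lker_qproj -ST SE -ky.
by rewrite memv_img ?memvf.
Qed.

(** The dual argument: take a submodule [T] of smallest dimension such that
    all submodules of [M / T] are in [Q]. If [T <> 0], a nonzero map from
    [T] into the common kernel of the radical maps on some [M_ i] shows that
    its kernel is a smaller such submodule. *)
Theorem all_subs_of_rad_reject :
  (forall i, all_subs Q (smod (rad_reject (M_ i) M))) -> all_subs Q M.
Proof.
move=> XQ.
have [||n [T TQ Tn] Tmax] := @bounded_max
    (fun n => exists2 T : submod M, all_subs Q (qmod T) &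
                (\dim {:M} - \dim T)%N = n)
    (\dim {:M}).
- exists (\dim {:M} - \dim (full_mod M))%N, (full_mod M) => //.
  by apply/all_subs_zero/full_mod_is_zero.
- by move=> _ [T _ <-]; rewrite leq_subr.
have [T0|TN] := eqVneq (svs T) 0%VS.
  by apply: all_subs_mono (@qproj_mhom _ _ _ T) _ TQ; rewrite lker_qproj.
pose p := incl T; have pA : is_mhom p := @incl_mhom _ _ _ T.
have /rad_socle[g [gA gp0 Jgp]] : p != 0.
  apply: contraNneq TN => p0.
  rewrite -[svs T]limg_incl -/p p0 -subv0.
  by apply/subvP => _ /memv_imgP[x _ ->]; rewrite zero_lfunE mem0v.
case: Mret => e [e1 eR].
have [i epg] : exists i, (e i \o (g \o p))%VF != 0.
  apply: contrapT => no; move/eqP: gp0; apply; apply/lfunP => x.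
  rewrite [LHS]e1 zero_lfunE big1 // => i _.
  have [/eqP E|NE] := boolP ((e i \o (g \o p))%VF == 0).
    by rewrite -comp_lfunE E zero_lfunE.
  by case: no; exists i.
have [a [b [aA bA ab eE]]] := eR i.
pose k := (a \o (g \o p))%VF.
have kA : is_mhom k by do !apply: mhom_comp.
have k0 : k != 0.
  apply: contraNneq epg => k0.
  by rewrite eE -comp_lfunA -/k k0 comp_lfun0r.
pose L := smod (im_mod kA).
have LQ : all_subs Q L.
  have kX : (limg (incl (im_mod kA)) <=
             limg (incl (rad_reject (M_ i) M)))%VS.
    rewrite !limg_incl; apply/subvP => _ /memv_imgP[x _ ->].
    apply/mem_rad_reject => f fR; rewrite -comp_lfunE /k comp_lfunA.
    by rewrite Jgp ?zero_lfunE //; exact: rad_compr.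
  have [h hA hE] := lift_mono (@incl_mhom _ _ _ (rad_reject (M_ i) M))
    (@incl_mhom _ _ _ (im_mod kA)) (lker_incl _) kX.
  apply: all_subs_mono hA _ (XQ i).
  apply/eqP; rewrite -subv0; apply/subvP => x /mem_lkerE hx; rewrite memv0.
  by apply/eqP/(inj_lfun (lker_incl (im_mod kA))); rewrite -hE hx linear0.
have [k' [k'A k'E k'T]] := corestrict kA.
have k'0 x : k' x = 0 <-> k x = 0.
  split=> [kx|kx]; first by rewrite -k'E kx linear0.
  by apply: (inj_lfun (lker_incl (im_mod kA))); rewrite k'E.
pose kerk := preim_mod kA (zero_mod (M_ i)).
have kerkE x : (x \in svs kerk) <-> k x = 0.
  by rewrite -memv_preim memv0; split=> /eqP.
(* The kernel of k, viewed inside M. *)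
pose S := im_mod (mhom_comp pA (@incl_mhom _ _ _ kerk)).
have SE x : (p x \in svs S) <-> k x = 0.
  split=> [/memv_imgP[y _]|kx].
    rewrite comp_lfunE => /(lker0P (introT eqP (lker_incl T))) ->.
    by apply/kerkE; rewrite inclE subvsP.
  have : x \in limg (incl kerk) by rewrite limg_incl; apply/kerkE.
  case/memv_imgP => y _ ->; apply/memv_imgP; exists y; first exact: memvf.
  by rewrite comp_lfunE.
have ST : (S <= T)%VS.
  by apply/subvP => _ /memv_imgP[x _ ->]; rewrite comp_lfunE /= /p inclE subvsP.
have kS : (lker k' <= lker (qproj S \o p))%VS.
  apply/subvP => x /mem_lkerE/k'0/SE px; apply/mem_lkerE; rewrite comp_lfunE.
  by apply/mem_lkerE; rewrite lker_qproj.
have [j jA jE] :=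
  ext_epi k'A (mhom_comp (@qproj_mhom _ _ _ S) pA) k'T kS.
have qST : (lker (qproj S) <= lker (qproj T))%VS by rewrite !lker_qproj.
have [q qA qE] :=
  ext_epi (@qproj_mhom _ _ _ S) (@qproj_mhom _ _ _ T) (qproj_surj S) qST.
have jq : exact3 j q.
  split=> //.
  - apply/eqP; rewrite -subv0; apply/subvP => y /mem_lkerE.
    have /memv_imgP[x _ ->] : y \in limg k' by rewrite k'T memvf.
    rewrite jE comp_lfunE => /mem_lkerE; rewrite lker_qproj => /SE/k'0 ->.
    by rewrite mem0v.
  - apply/vspaceP => y; apply/memv_imgP/idP => [[z _ ->]|].
      apply/mem_lkerE.
      have /memv_imgP[x _ ->] : z \in limg k' by rewrite k'T memvf.
      rewrite jE comp_lfunE qE; apply/mem_lkerE.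
      by rewrite lker_qproj /p inclE subvsP.
    have /memv_imgP[x _ ->] : y \in limg (qproj S) by rewrite qproj_surj memvf.
    move/mem_lkerE; rewrite qE => /mem_lkerE; rewrite lker_qproj -(limg_incl T).
    case/memv_imgP => t _ ->; exists (k' t); first exact: memvf.
    by rewrite jE comp_lfunE.
  - apply/eqP; rewrite eqEsubv subvf -(qproj_surj T).
    apply/subvP => _ /memv_imgP[x _ ->].
    by rewrite -qE memv_img ?memvf.
(* M / S is an extension of M / T by the image of k, so minimality gives
   S = T, that is k = 0. *)
have := Tmax _ (ex_intro2 _ _ S (all_subs_ext Qext jq LQ TQ) erefl).
rewrite -Tn => le.
have {}ST : svs S = svs T.
  apply/eqP; rewrite eqEdim ST /=.
  by rewrite -(leq_sub2lE (m := \dim {:M})) // dimvS ?subvf.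
case/eqP: k0; apply/lfunP => x; rewrite zero_lfunE.
by apply/SE; rewrite ST /p inclE subvsP.
Qed.

Lemma all_factors_retract N (f : 'Hom(M, N)) (g : 'Hom(N, M)) :
  is_mhom f -> (f \o g)%VF = \1%VF -> all_factors Q M -> all_factors Q N.
Proof.
move=> fA fg; apply: all_factors_epi fA _; apply/vspaceP => x; rewrite memvf.
by apply/memv_imgP; exists (g x); rewrite ?memvf // -comp_lfunE fg id_lfunE.
Qed.

Lemma all_subs_retract N (f : 'Hom(N, M)) (g : 'Hom(M, N)) :
  is_mhom f -> (g \o f)%VF = \1%VF -> all_subs Q M -> all_subs Q N.
Proof.
move=> fA fg; apply: all_subs_mono fA _; apply/eqP; rewrite -subv0.
apply/subvP => x /mem_lkerE fx; rewrite memv0 -[x]id_lfunE -fg comp_lfunE fx.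
by rewrite linear0.
Qed.

Theorem all_factors_rad_top :
  all_factors Q M <-> forall i, all_factors Q (qmod (rad_trace M (M_ i))).
Proof.
split=> [MQ i|]; last exact: all_factors_of_rad_trace.
have [_ [_ /(_ i)[a [b [aA _ ab _]]]]] := Mret.
apply: all_factors_epi (@qproj_mhom _ _ _ _) (qproj_surj _) _.
exact: all_factors_retract aA ab MQ.
Qed.

Theorem all_subs_rad_soc :
  all_subs Q M <-> forall i, all_subs Q (smod (rad_reject (M_ i) M)).
Proof.
split=> [MQ i|]; last exact: all_subs_of_rad_reject.
have [_ [_ /(_ i)[a [b [_ bA ab _]]]]] := Mret.
apply: all_subs_mono (@incl_mhom _ _ _ _) (lker_incl _) _.
exact: all_subs_retract bA ab MQ.
Qed.
End RadicalTop.

Section DirectSums.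
Variables (K : fieldType) (A : falgType K).
Variables (Q : rmodule A -> Prop) (Qext : ext_closed Q).

Lemma exact3_dsum (M N : rmodule A) : exists (i : 'Hom(M, mdsum M N))
  (j : 'Hom(N, mdsum M N)) (p : 'Hom(mdsum M N, M)) (q : 'Hom(mdsum M N, N)),
  exact3 i q /\ exact3 j p.
Proof.
pose i : 'Hom(M, mdsum M N) := linfun (fun x => (x, 0)).
pose j : 'Hom(N, mdsum M N) := linfun (fun x => (0, x)).
pose p : 'Hom(mdsum M N, M) := linfun (fun x => x.1).
pose q : 'Hom(mdsum M N, N) := linfun (fun x => x.2).
have iE x : i x = (x, 0).
  by apply: linfunE => k u v; congr pair; rewrite /= scaler0 addr0.
have jE x : j x = (0, x).
  by apply: linfunE => k u v; congr pair; rewrite /= scaler0 addr0.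
have pE x : p x = x.1 by apply: linfunE.
have qE x : q x = x.2 by apply: linfunE.
exists i, j, p, q; split; split.
- by move=> x a; rewrite !iE /= /dsum_act /= ract0.
- by move=> x a; rewrite !qE.
- by apply/eqP/lker0P => x y; rewrite !iE => -[].
- apply/vspaceP => -[x y]; apply/memv_imgP/idP => [[z _ ->]|/mem_lkerE].
    by apply/mem_lkerE; rewrite iE qE.
  by rewrite qE /= => ->; exists x; rewrite ?memvf ?iE.
- apply/vspaceP => x; rewrite memvf; apply/memv_imgP.
  by exists (0, x); rewrite ?memvf ?qE.
- by move=> x a; rewrite !jE /= /dsum_act /= ract0.
- by move=> x a; rewrite !pE.
- by apply/eqP/lker0P => x y; rewrite !jE => -[].
- apply/vspaceP => -[x y]; apply/memv_imgP/idP => [[z _ ->]|/mem_lkerE].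
    by apply/mem_lkerE; rewrite jE pE.
  by rewrite pE /= => ->; exists y; rewrite ?memvf ?jE.
- apply/vspaceP => x; rewrite memvf; apply/memv_imgP.
  by exists (x, 0); rewrite ?memvf ?pE.
Qed.

Lemma all_factors_bigsum m (M_ : 'I_m -> rmodule A) :
  all_factors Q (\big[@mdsum K A/mzero A]_(i < m) M_ i) <->
  forall i, all_factors Q (M_ i).
Proof.
elim: m M_ => [|m IH] M_.
  rewrite big_ord0; split=> [_ []//|_].
  exact/(all_factors_zero Qext)/mzero_is_zero.
rewrite big_ord_recl.
set N := \big[_/_]_(_ < m) _; have {}IH := IH (fun i => M_ (lift ord0 i)).
have [i [j [p [q [iq jp]]]]] := exact3_dsum (M_ ord0) N.
split=> [MQ l|MQ]; last first.
  by apply: (all_factors_ext Qext iq) => //; apply/IH.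
case: (unliftP ord0 l) => [h|] ->.
  apply: ((IH.1 _) h); case: iq => _ qA _ _ qT.
  exact: all_factors_epi qA qT MQ.
by case: jp => _ pA _ _ pT; exact: all_factors_epi pA pT MQ.
Qed.

Lemma all_subs_bigsum m (M_ : 'I_m -> rmodule A) :
  all_subs Q (\big[@mdsum K A/mzero A]_(i < m) M_ i) <->
  forall i, all_subs Q (M_ i).
Proof.
elim: m M_ => [|m IH] M_.
  rewrite big_ord0; split=> [_ []//|_].
  exact/(all_subs_zero Qext)/mzero_is_zero.
rewrite big_ord_recl.
set N := \big[_/_]_(_ < m) _; have {}IH := IH (fun i => M_ (lift ord0 i)).
have [i [j [p [q [iq jp]]]]] := exact3_dsum (M_ ord0) N.
split=> [MQ l|MQ]; last first.
  by apply: (all_subs_ext Qext iq) => //; apply/IH.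
case: (unliftP ord0 l) => [h|] ->.
  apply: ((IH.1 _) h); case: jp => jA _ j0 _ _.
  exact: all_subs_mono jA j0 MQ.
by case: iq => iA _ i0 _ _; exact: all_subs_mono iA i0 MQ.
Qed.
End DirectSums.

(** * Functors on the homotopy category *)

Section Homotopy.
Variables (K : fieldType) (A : falgType K).
Implicit Types C D E : cplx A.

(** Additive functors on complexes that factor through the homotopy
    category. *)
Record homotopy_functor (F : cplx A -> rmodule A)
    (Fm : forall C D, cmap C D -> 'Hom(F C, F D)) : Prop := HomotopyFunctor {
  hf_mhom : forall C D (f : cmap C D), is_cmap f -> is_mhom (Fm C D f);
  hf_comp : forall C D E (f : cmap C D) (g : cmap D E),
    is_cmap f -> is_cmap g ->
    Fm C E (fun i => (g i \o f i)%VF) = (Fm D E g \o Fm C D f)%VF;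
  hf_id : forall C, Fm C C (fun i => \1%VF) = \1%VF;
  hfD : forall C D (f g : cmap C D),
    Fm C D (fun i => f i + g i) = Fm C D f + Fm C D g;
  hf_null : forall C D (f : cmap C D), null_homotopic f -> Fm C D f = 0 }.

Lemma cmap_comp C D E (f : cmap C D) (g : cmap D E) :
  is_cmap f -> is_cmap g -> is_cmap (fun i => (g i \o f i)%VF).
Proof.
move=> [fA fd] [gA gd]; split=> [i|i j]; first exact: mhom_comp.
by rewrite comp_lfunA gd -comp_lfunA fd comp_lfunA.
Qed.

Section Cohomology.
Variable i : int.

(** Meaningful on cocycles only; the definition on all of [C i], through the
    projection onto the cocycles, makes it a linear map to which linearity
    lemmas apply. *)
Definition cocycle_class C : 'Hom(C i, cohom C i) :=
  (qproj (Submod (@cobound_stable _ _ C i)) \o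
     (linfun (vsproj (cocycles C i)) : 'Hom(C i, smod (cocycles C i))))%VF.

(** A linear section of [cocycle_class]; it need not commute with the action
    of [A]. *)
Definition class_rep C : 'Hom(cohom C i, C i) :=
  (incl (cocycles C i) \o
    (linfun vsval : 'Hom(cohom C i, smod (cocycles C i))))%VF.

Lemma class_repK C : cancel (class_rep C) (cocycle_class C).
Proof.
move=> h; rewrite !comp_lfunE qprojE inclE !lfunE /= vsvalK.
exact: (@qproj_funK _ _ _ (Submod (@cobound_stable _ _ C i)) h).
Qed.

Lemma class_rep_cocycle C h : cd C i (i + 1) (class_rep C h) = 0.
Proof. by apply/mem_lkerE; rewrite comp_lfunE inclE; exact: subvsP. Qed.

Lemma cocycle_class_eq0 C x : cd C i (i + 1) x = 0 ->
  (cocycle_class C x = 0) <-> (x \in limg (cd C (i - 1) i)).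
Proof.
move=> /mem_lkerE dx; rewrite comp_lfunE qprojE lfunE.
have := qproj_fun_eq0 (Submod (@cobound_stable _ _ C i))
  (vsproj (cocycles C i) x).
rewrite /= /cobound -memv_preim lfunE /= vsprojK // => <-.
by split=> /eqP.
Qed.

Lemma cocycle_class_act C x a : cd C i (i + 1) x = 0 ->
  cocycle_class C (ract x a) = ract (cocycle_class C x) a.
Proof.
move=> /mem_lkerE dx; rewrite !comp_lfunE -qproj_mhom; congr (qproj _ _).
rewrite !lfunE; apply: val_inj => /=.
by rewrite !vsprojK // cocycles_stable.
Qed.

(** This is a morphism of modules although [class_rep] is only linear,
    because by [cohom_mapE] the choice of representatives does not matter
    for a map of complexes. *)
Definition cohom_map C D (f : cmap C D) : 'Hom(cohom C i, cohom D i) :=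
  (cocycle_class D \o (f i \o class_rep C))%VF.

Lemma cohom_map_def C D (f : cmap C D) h :
  cohom_map f h = cocycle_class D (f i (class_rep C h)).
Proof. by rewrite comp_lfunE [in LHS]comp_lfunE. Qed.

Lemma cmap_cocycle C D (f : cmap C D) x : is_cmap f ->
  cd C i (i + 1) x = 0 -> cd D i (i + 1) (f i x) = 0.
Proof. by case=> _ fd dx; rewrite -comp_lfunE fd comp_lfunE dx linear0. Qed.

(** The chosen representative differs from [x] by a coboundary, which a map
    of complexes sends to a coboundary. *)
Lemma cohom_mapE C D (f : cmap C D) x : is_cmap f ->
  cd C i (i + 1) x = 0 ->
  cohom_map f (cocycle_class C x) = cocycle_class D (f i x).
Proof.
move=> fC dx; rewrite cohom_map_def; apply/eqP; rewrite -subr_eq0 -!linearB /=.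
set y := _ - x.
have dy : cd C i (i + 1) y = 0 by rewrite linearB /= class_rep_cocycle dx subr0.
have : cocycle_class C y = 0 by rewrite linearB /= class_repK subrr.
move/(cocycle_class_eq0 dy) => /memv_imgP[z _ yz].
apply/eqP/cocycle_class_eq0; first exact: cmap_cocycle.
by case: fC => _ fd; rewrite yz -comp_lfunE -fd comp_lfunE memv_img ?memvf.
Qed.

Lemma cohom_homotopy_functor :
  @homotopy_functor (fun C => cohom C i) (@cohom_map).
Proof.
split=> [C D f fC h a|C D E f g fC gC|C|C D f g|C D f [s [sA fs]]].
- have dh := class_rep_cocycle h.
  rewrite -{1}(class_repK h) -cocycle_class_act // cohom_mapE //; last first.
    by rewrite cd_mhom dh ract0.
  have [fA _] := fC; rewrite fA cocycle_class_act ?cohom_map_def //.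
  exact: cmap_cocycle.
- apply/lfunP => h; have dh := class_rep_cocycle h.
  rewrite -(class_repK h) [RHS]comp_lfunE !cohom_mapE //.
  + by rewrite [X in cocycle_class E X]comp_lfunE.
  + exact: cmap_cocycle.
  + exact: cmap_comp.
- by apply/lfunP => h; rewrite cohom_map_def !id_lfunE class_repK.
- apply/lfunP => h; rewrite [RHS]add_lfunE !cohom_map_def -linearD /=.
  by rewrite add_lfunE.
- apply/lfunP => h; rewrite cohom_map_def zero_lfunE fs add_lfunE.
  rewrite [X in _ + X]comp_lfunE class_rep_cocycle linear0 addr0.
  rewrite [X in cocycle_class D X]comp_lfunE.
  apply/cocycle_class_eq0; first by rewrite -comp_lfunE cd_sq zero_lfunE.
  by rewrite memv_img ?memvf.
Qed.
End Cohomology.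

Lemma nak_mapD (P Q : rmodule A) (f g : 'Hom(P, Q)) :
  nak_map (f + g) = nak_map f + nak_map g.
Proof.
apply/lfunP => phi; apply/lfunP => h.
rewrite add_lfunE [in RHS]add_lfunE !nak_mapE -linearD.
by congr (fun_of_lfun phi _); rewrite /nak_pre comp_lfunDr linearD.
Qed.

Lemma nak_map1 (P : rmodule A) : nak_map (\1%VF : 'End(P)) = \1%VF.
Proof.
apply/lfunP => phi; apply/lfunP => h; rewrite nak_mapE id_lfunE.
by rewrite /nak_pre comp_lfun1r vsvalK.
Qed.

Definition cnak_map C D (f : cmap C D) : cmap (cnak C) (cnak D) :=
  fun i => nak_map (f i).

Lemma cnak_map_cmap C D (f : cmap C D) : is_cmap f -> is_cmap (cnak_map f).
Proof.
move=> [fA fd]; split=> [i|i j]; first exact: nak_map_mhom.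
by rewrite /= /cnak_d -!nak_map_comp ?fd //; exact: cd_mhom.
Qed.

Lemma homotopy_functor_nak F Fm : @homotopy_functor F Fm ->
  homotopy_functor (fun C D (f : cmap C D) => Fm _ _ (cnak_map f)).
Proof.
case=> Fmhom Fcomp Fid FD Fnull.
split=> [C D f fC|C D E f g fC gC|C|C D f g|C D f [s [sA fs]]].
- exact/Fmhom/cnak_map_cmap.
- rewrite -Fcomp; [|exact: cnak_map_cmap..].
  congr (Fm _ _ _); apply: functional_extensionality_dep => k.
  by rewrite /cnak_map nak_map_comp //; [case: fC | case: gC].
- rewrite -Fid; congr (Fm _ _ _); apply: functional_extensionality_dep => k.
  exact: nak_map1.
- rewrite -FD; congr (Fm _ _ _); apply: functional_extensionality_dep => k.
  exact: nak_mapD.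
- apply: Fnull; exists (fun i j => nak_map (s i j)); split=> [k j|k].
    exact: nak_map_mhom.
  rewrite /cnak_map fs nak_mapD !nak_map_comp //; exact: cd_mhom.
Qed.

(** As for [sum_of_retracts], with strict equalities of maps of complexes. *)
Definition csum_of_retracts (I : finType) C (C_ : I -> cplx A) :=
  exists e : I -> cmap C C,
    (forall k, \1%VF = \sum_i e i k) /\
    forall i, exists (p : cmap C (C_ i)) (q : cmap (C_ i) C),
      [/\ is_cmap p, is_cmap q, forall k, (p k \o q k)%VF = \1%VF &
          forall k, e i k = (q k \o p k)%VF].

Lemma csum_bigsum m (C_ : 'I_m -> cplx A) :
  csum_of_retracts (\big[@cdsum K A/czero A]_(i < m) C_ i) C_.
Proof.
elim: m C_ => [|m IH] C_.
  rewrite big_ord0; exists (fun i k => 0); split=> [k|[]//].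
  by rewrite big_ord0; apply/lfunP => x; apply/rowP; case.
rewrite big_ord_recl.
set D := \big[_/_]_(_ < m) _; set C := C_ ord0.
have [e [e1 eR]] : csum_of_retracts D (fun i => C_ (lift ord0 i)) by exact: IH.
pose i1 k : 'Hom(C k, cdsum C D k) := linfun (fun x => (x, 0)).
pose i2 k : 'Hom(D k, cdsum C D k) := linfun (fun x => (0, x)).
pose p1 k : 'Hom(cdsum C D k, C k) := linfun (fun x => x.1).
pose p2 k : 'Hom(cdsum C D k, D k) := linfun (fun x => x.2).
have i1E k x : i1 k x = (x, 0).
  by apply: linfunE => c u v; congr pair; rewrite /= scaler0 addr0.
have i2E k x : i2 k x = (0, x).
  by apply: linfunE => c u v; congr pair; rewrite /= scaler0 addr0.
have p1E k x : p1 k x = x.1 by apply: linfunE.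
have p2E k x : p2 k x = x.2 by apply: linfunE.
have i1C : is_cmap i1.
  split=> [k x a|k j]; first by rewrite !i1E /= /dsum_act /= ract0.
  by apply/lfunP => x; rewrite !comp_lfunE !i1E cdsum_dE /= linear0.
have i2C : is_cmap i2.
  split=> [k x a|k j]; first by rewrite !i2E /= /dsum_act /= ract0.
  by apply/lfunP => x; rewrite !comp_lfunE !i2E cdsum_dE /= linear0.
have p1C : is_cmap p1.
  split=> [k x a|k j]; first by rewrite !p1E.
  by apply/lfunP => x; rewrite !comp_lfunE !p1E cdsum_dE.
have p2C : is_cmap p2.
  split=> [k x a|k j]; first by rewrite !p2E.
  by apply/lfunP => x; rewrite !comp_lfunE !p2E cdsum_dE.
exists (fun i => if unlift ord0 i is Some j
  then fun k => (i2 k \o (e j k \o p2 k))%VF else fun k => (i1 k \o p1 k)%VF).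
split=> [k|i].
  rewrite big_ord_recl unlift_none; apply/lfunP => x.
  rewrite id_lfunE add_lfunE sum_lfunE comp_lfunE i1E p1E.
  transitivity ((x.1, 0) + i2 k (\sum_i e i k (p2 k x))).
    rewrite -sum_lfunE -e1 id_lfunE i2E p2E.
    by case: x => u v; congr pair; rewrite /= ?addr0 ?add0r.
  congr (_ + _); rewrite linear_sum; apply: eq_bigr => j _.
  by rewrite liftK !comp_lfunE.
case: (unliftP ord0 i) => [j|] ->; last first.
  exists p1, i1; split=> // k; apply/lfunP => x.
  by rewrite comp_lfunE i1E p1E id_lfunE.
have [p [q [pC qC pq eE]]] := eR j.
exists (fun k => p k \o p2 k)%VF, (fun k => i2 k \o q k)%VF; split.
- exact: cmap_comp.
- exact: cmap_comp.
- move=> k; rewrite -(pq k); apply/lfunP => x.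
  by rewrite !comp_lfunE i2E p2E.
- by move=> k; rewrite eE !comp_lfunA.
Qed.

Lemma hf_sum F Fm (HF : @homotopy_functor F Fm) (I : finType) C D
    (f : I -> cmap C D) :
  Fm _ _ (fun k => \sum_i f i k) = \sum_i Fm _ _ (f i).
Proof.
have hf0 : Fm C D (fun k => 0) = 0.
  apply: (hf_null HF); exists (fun _ _ => 0); split=> *; first exact: mhom0.
  by rewrite comp_lfun0r comp_lfun0l addr0.
rewrite unlock; elim: (index_enum I) => [|i r IH] /=; first exact: hf0.
by rewrite (hfD HF) IH.
Qed.

Lemma hf_homotopic F Fm (HF : @homotopy_functor F Fm) C (f : cmap C C) :
  null_homotopic (fun k => f k - \1%VF) -> Fm _ _ f = \1%VF.
Proof.
move=> /(hf_null HF) f1; rewrite -(hf_id HF) -[RHS]add0r -{}f1 -(hfD HF).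
congr (Fm _ _ _); apply: functional_extensionality_dep => k.
by rewrite subrK.
Qed.

(** Transport the idempotents of [C] along the isomorphism after applying
    the functor, where homotopies have become equalities. *)
Lemma hf_sum_of_retracts F Fm (HF : @homotopy_functor F Fm) (I : finType)
    U C (C_ : I -> cplx A) :
  iso_K U C -> csum_of_retracts C C_ ->
  sum_of_retracts (F U) (fun i => F (C_ i)).
Proof.
move=> [f [g [fC gC gf fg]]] [e [e1 eR]].
have gfE : (Fm _ _ g \o Fm _ _ f)%VF = \1%VF.
  by rewrite -(hf_comp HF) // (hf_homotopic HF).
have fgE : (Fm _ _ f \o Fm _ _ g)%VF = \1%VF.
  by rewrite -(hf_comp HF) // (hf_homotopic HF).
exists (fun i => Fm _ _ g \o (Fm _ _ (e i) \o Fm _ _ f))%VF; split=> [x|i].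
  rewrite -[LHS]id_lfunE -gfE comp_lfunE -[Fm U C f x]id_lfunE.
  rewrite -(hf_id HF).
  rewrite (_ : (fun k => \1%VF) = (fun k => \sum_i e i k)); last first.
    by apply: functional_extensionality_dep => k; exact: e1.
  rewrite (hf_sum HF) sum_lfunE linear_sum.
  by apply: eq_bigr => i _; rewrite !comp_lfunE.
have [p [q [pC qC pq eE]]] := eR i.
exists (Fm _ _ p \o Fm _ _ f)%VF, (Fm _ _ g \o Fm _ _ q)%VF; split.
- by apply: mhom_comp; exact: (hf_mhom HF).
- by apply: mhom_comp; exact: (hf_mhom HF).
- rewrite comp_lfunA -[((_ \o _) \o Fm _ _ g)%VF]comp_lfunA fgE comp_lfun1r.
  rewrite -(hf_comp HF) // -(hf_id HF); congr (Fm _ _ _).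
  by apply: functional_extensionality_dep => k; exact: pq.
- have -> : e i = (fun k => q k \o p k)%VF.
    by apply: functional_extensionality_dep => k; exact: eE.
  by rewrite (hf_comp HF) // !comp_lfunA.
Qed.
End Homotopy.

(** * The Euler form on short exact sequences *)

Section Euler.
Variables (R : realType) (K : fieldType) (A : falgType K).

(** For projective [P] the functor [Hom(P, -)] is exact; count dimensions
    with rank-nullity for composition with [g]. *)
Lemma dim_homA_exact (P L M N : rmodule A) (f : 'Hom(L, M)) (g : 'Hom(M, N)) :
  is_projective P -> exact3 f g ->
  \dim (homA P M) = (\dim (homA P L) + \dim (homA P N))%N.
Proof.
move=> PP [fA gA f0 fg gT].
pose F : 'Hom('Hom(P, L), 'Hom(P, M)) := linfun (fun u => (f \o u)%VF).
pose G : 'Hom('Hom(P, M), 'Hom(P, N)) := linfun (fun u => (g \o u)%VF).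
have FE u : F u = (f \o u)%VF.
  by apply: linfunE => k v w; rewrite comp_lfunDr -comp_lfunZr.
have GE u : G u = (g \o u)%VF.
  by apply: linfunE => k v w; rewrite comp_lfunDr -comp_lfunZr.
have F0 : lker F = 0%VS.
  apply/eqP; rewrite -subv0; apply/subvP => u; rewrite memv_ker memv0 FE.
  move=> /eqP fu; apply/eqP/lfunP => x; rewrite zero_lfunE.
  by apply: (inj_lfun f0); rewrite -comp_lfunE fu zero_lfunE.
have kerG : (homA P M :&: lker G)%VS = (F @: homA P L)%VS.
  apply/vspaceP => u; rewrite memv_cap memv_ker; apply/andP/idP.
    rewrite GE => -[/mem_homA uA /eqP gu].
    have uf : (limg u <= limg f)%VS.
      apply/subvP => _ /memv_imgP[x _ ->]; rewrite fg; apply/mem_lkerE.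
      by rewrite -comp_lfunE gu zero_lfunE.
    have [v vA vE] := lift_mono fA uA f0 uf.
    have -> : u = F v by apply/lfunP => x; rewrite FE comp_lfunE vE.
    exact/memv_img/mem_homA.
  case/memv_imgP => v /mem_homA vA ->; rewrite FE GE; split.
    exact/mem_homA/mhom_comp.
  apply/eqP/lfunP => x; rewrite !comp_lfunE zero_lfunE; apply/mem_lkerE.
  by rewrite -fg memv_img ?memvf.
have imG : (G @: homA P M)%VS = homA P N.
  apply/vspaceP => u; apply/memv_imgP/idP => [[v /mem_homA vA ->]|/mem_homA uA].
    by rewrite GE; exact/mem_homA/mhom_comp.
  have [h hA hE] := PP M N g u gA uA gT.
  by exists h; [exact/mem_homA | rewrite GE].
by rewrite -(limg_ker_dim G (homA P M)) kerG imG limg_dim_eq // F0 capv0.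
Qed.

Lemma euler_exact (theta : K0R R A) (L M N : rmodule A)
    (f : 'Hom(L, M)) (g : 'Hom(M, N)) :
  exact3 f g -> euler theta M = euler theta L + euler theta N.
Proof.
move=> fg; rewrite /euler -[repr theta]freeg.freeg_sumE !euler_free_sum.
rewrite -big_split; apply: eq_bigr => P _ /=.
rewrite /euler_free !freeg.liftU.
by rewrite (dim_homA_exact (@cproj_projective _ _ P) fg) natrD scalerDr.
Qed.

(** The zero module must be admitted explicitly, since for strict signs it
    fails the inequality. *)
Definition nz_euler (theta : K0R R A) (P : R -> Prop) (M : rmodule A) :=
  ~ is_zero M -> P (euler theta M).

Lemma is_zeroE (M : rmodule A) : is_zero M <-> forall x : M, x = 0.
Proof.
split=> [M0 x|M0]; first by apply/eqP; rewrite -memv0 -M0 memvf.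
by apply/eqP; rewrite -subv0; apply/subvP => x _; rewrite (M0 x) mem0v.
Qed.

Lemma nz_euler_ext theta (P : R -> Prop) :
  (forall x y, P x -> P y -> P (x + y)) -> ext_closed (nz_euler theta P).
Proof.
move=> PD; split=> [X X0 []//|L M N f g fg PL PN MN].
have euler0 X : is_zero X -> euler theta X = 0.
  (* The sequence X -> X -> X is exact when X is zero. *)
  move=> /is_zeroE X0; apply: (addrI (euler theta X)); rewrite addr0.
  rewrite -(@euler_exact _ _ _ _ (\1%VF : 'End(X)) (\1%VF : 'End(X))) //.
  have kerT (h : 'End(X)) : lker h = fullv.
    by apply/vspaceP => x; rewrite memvf (X0 x) mem0v.
  have im0 (h : 'End(X)) : limg h = fullv.
    by apply/vspaceP => x; rewrite memvf (X0 x) mem0v.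
  split; [exact: mhom_id | exact: mhom_id | | | exact: im0].
    by rewrite kerT; apply/is_zeroE.
  by rewrite im0 kerT.
rewrite (euler_exact theta fg).
case: fg => _ _ f0 fgE gT.
have [L0|LN] := pselect (is_zero L); have [N0|NN] := pselect (is_zero N).
- case: MN; apply/is_zeroE => x.
  have /memv_imgP[y _ ->] : x \in limg f.
    by rewrite fgE; apply/mem_lkerE; move/is_zeroE: N0.
  by move/is_zeroE: L0 => /(_ y) ->; rewrite linear0.
- by rewrite euler0 // add0r; exact: PN.
- by rewrite [euler _ N]euler0 // addr0; exact: PL.
- by apply: PD; [exact: PL | exact: PN].
Qed.

Variable theta : K0R R A.

Lemma ge0_ext : ext_closed (nz_euler theta (fun x => 0 <= x)).
Proof. by apply: nz_euler_ext => x y; exact: addr_ge0. Qed.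
Lemma gt0_ext : ext_closed (nz_euler theta (fun x => 0 < x)).
Proof. by apply: nz_euler_ext => x y; exact: addr_gt0. Qed.
Lemma le0_ext : ext_closed (nz_euler theta (fun x => x <= 0)).
Proof. by apply: nz_euler_ext => x y x0 y0; rewrite -(addr0 0) lerD. Qed.
Lemma lt0_ext : ext_closed (nz_euler theta (fun x => x < 0)).
Proof. by apply: nz_euler_ext => x y x0 y0; rewrite -(addr0 0) ltrD. Qed.

End Euler.

Section TwoTerm.
Variables (K : fieldType) (A : falgType K).
Variables (m : nat) (U : cplx A) (U_ : 'I_m -> cplx A).
Hypothesis U_sum : iso_K U (\big[@cdsum K A/czero A]_(i < m) U_ i).
Variables (Q : rmodule A -> Prop) (Qext : ext_closed Q).

Lemma all_factors_H0 :
  all_factors Q (H0 U) <-> forall i, all_factors Q (Yplus U (U_ i)).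
Proof.
have HR := hf_sum_of_retracts (cohom_homotopy_functor A 0) U_sum
  (csum_bigsum U_).
exact: (all_factors_rad_top Qext HR).
Qed.

Lemma all_subs_Hm1nu :
  all_subs Q (Hm1nu U) <-> forall i, all_subs Q (Xminus U (U_ i)).
Proof.
have HR := hf_sum_of_retracts 
  (homotopy_functor_nak (cohom_homotopy_functor A (-1))) U_sum
  (csum_bigsum U_).
exact: (all_subs_rad_soc Qext HR).
Qed.
End TwoTerm.

Theorem proposition1p3 (R : realType) (K : fieldType) (A : falgType K)
    (m : nat) (U : cplx A) (U_ : 'I_m -> cplx A)
    (U_psilt : two_psilt U)
    (U_indec : forall i : 'I_m, in_Kb_proj (U_ i) /\ indecomposable (U_ i))
    (U_sum : iso_K U (\big[@cdsum K A/czero A]_(i < m) U_ i)) :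
  let Y (i : 'I_m) : rmodule A := Yplus U (U_ i) in
  let X (i : 'I_m) : rmodule A := Xminus U (U_ i) in
  let Ysum : rmodule A := \big[@mdsum K A/mzero A]_(i < m) Y i in
  let Xsum : rmodule A := \big[@mdsum K A/mzero A]_(i < m) X i in
  [/\ Dcone R U = [set theta : K0R R A | Tbar theta Ysum /\ Fbar theta Xsum],
      [set theta : K0R R A | Tbar theta Ysum /\ Fbar theta Xsum] =
      \bigcap_(i in [set: 'I_m])
        [set theta : K0R R A | Tbar theta (Y i) /\ Fbar theta (X i)],
      Dcone_open R U =
      [set theta : K0R R A | Tstab theta Ysum /\ Fstab theta Xsum] &
      [set theta : K0R R A | Tstab theta Ysum /\ Fstab theta Xsum] =
      \bigcap_(i in [set: 'I_m])
        [set theta : K0R R A | Tstab theta (Y i) /\ Fstab theta (X i)]].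
Proof.
move=> Y X Ysum Xsum.
have capE (T F : K0R R A -> rmodule A -> Prop) :
    (forall t, T t Ysum <-> forall i, T t (Y i)) ->
    (forall t, F t Xsum <-> forall i, F t (X i)) ->
    [set theta : K0R R A | T theta Ysum /\ F theta Xsum] =
    \bigcap_(i in [set: 'I_m]) [set theta | T theta (Y i) /\ F theta (X i)].
  move=> TE FE; apply/seteqP; split=> t /=.
    by move=> [/TE tY /FE tX] i _; split.
  by move=> h; split; [apply/TE => i|apply/FE => i]; case: (h i).
have coneE (T F : K0R R A -> rmodule A -> Prop) :
    (forall t, T t (H0 U) <-> T t Ysum) ->
    (forall t, F t (Hm1nu U) <-> F t Xsum) ->
    [set theta : K0R R A | T theta (H0 U) /\ F theta (Hm1nu U)] =
    [set theta : K0R R A | T theta Ysum /\ F theta Xsum].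
  by move=> TE FE; apply/seteqP; split=> t /= [/TE ? /FE ?].
have TbE (t : K0R R A) M :
    Tbar t M <-> all_factors (nz_euler t (fun x => 0 <= x)) M :=
    iff_sym (all_factorsE (ge0_ext (R := R) t) M).
have TsE (t : K0R R A) M :
    Tstab t M <-> all_factors (nz_euler t (fun x => 0 < x)) M :=
    iff_sym (all_factorsE (gt0_ext (R := R) t) M).
have FbE (t : K0R R A) M :
    Fbar t M <-> all_subs (nz_euler t (fun x => x <= 0)) M :=
    iff_sym (all_subsE (le0_ext (R := R) t) M).
have FsE (t : K0R R A) M :
    Fstab t M <-> all_subs (nz_euler t (fun x => x < 0)) M :=
    iff_sym (all_subsE (lt0_ext (R := R) t) M).
have YE Q (Qext : ext_closed Q) : all_factors Q (H0 U) <-> all_factors Q Ysum.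
  by rewrite (all_factors_H0 U_sum Qext) (all_factors_bigsum Qext).
have XE Q (Qext : ext_closed Q) : all_subs Q (Hm1nu U) <-> all_subs Q Xsum.
  by rewrite (all_subs_Hm1nu U_sum Qext) (all_subs_bigsum Qext).
have YiE Q (Qext : ext_closed Q) := all_factors_bigsum Qext Y.
have XiE Q (Qext : ext_closed Q) := all_subs_bigsum Qext X.
split.
- apply: (coneE (fun t M => Tbar t M) (fun t M => Fbar t M)) => t.
    by rewrite !TbE; exact/YE/ge0_ext.
  by rewrite !FbE; exact/XE/le0_ext.
- apply: (capE (fun t M => Tbar t M) (fun t M => Fbar t M)) => t.
    rewrite TbE (YiE _ (ge0_ext t)).
    by split=> h i; apply/TbE.
  rewrite FbE (XiE _ (le0_ext t)).
  by split=> h i; apply/FbE.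
- apply: (coneE (fun t M => Tstab t M) (fun t M => Fstab t M)) => t.
    by rewrite !TsE; exact/YE/gt0_ext.
  by rewrite !FsE; exact/XE/lt0_ext.
- apply: (capE (fun t M => Tstab t M) (fun t M => Fstab t M)) => t.
    rewrite TsE (YiE _ (gt0_ext t)).
    by split=> h i; apply/TsE.
  rewrite FsE (XiE _ (lt0_ext t)).
  by split=> h i; apply/FsE.
Qed.
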